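(* Let $x\ge 1$ and $z\ge 1$ be sufficiently large real numbers, and let $k\ge 2$ be an integer such that $k\le (\log\log z)^{1/3}$ and $e^{e^{k^3}}\le z\le x^{1/k}$. Then the following hold uniformly in $k$, $z$ and $x$ (i.e. all implied constants are absolute). (a) If $k\ge 2$ is even, then $$\sum_{n\le x}(\omega_z(n)-\log\log z)^k = C_k\, x(\log\log z)^{\frac k2}\left(1+O\left(\frac{k^3}{\log\log z}\right)\right).$$ (b) If $k\ge 3$ is odd, then: (I) if $3\le k\le (\log\log z)^{1/7}$, $$\sum_{n\le x}(\omega_z(n)-\log\log z)^k=\tilde C_k x(\log\log z)^{\frac{k-1}{2}}+B(k^{3/2}C_k)x(\log\log z)^{\frac{k-1}{2}}\left(\frac{C_{k-1}}{k^{1/2}C_k}\right)+O\left((k^{3/2}C_k)x(\log\log z)^{\frac{k-1}{2}}\cdot\frac{1}{(k\log\log z)^{1/2}}\right);$$ (II) if $(\log\log z)^{1/7}<k<(\log\log z)^{1/4}$, $$\sum_{n\le x}(\omega_z(n)-\log\log z)^k=\tilde C_k x(\log\log z)^{\frac{k-1}{2}}+B(k^{3/2}C_k)x(\log\log z)^{\frac{k-1}{2}}\left(\frac{C_{k-1}}{k^{1/2}C_k}\right)+O\left((k^{3/2}C_k)x(\log\log z)^{\frac{k-1}{2}}\frac{k^3}{\log\log z}\right);$$ (III) if $(\log\log z)^{1/4}\le k\le(\log\log z)^{1/3}$, $$\sum_{n\le x}(\omega_z(n)-\log\log z)^k=\tilde C_k x(\log\log z)^{\frac{k-1}{2}}+O\left((k^{3/2}C_k)x(\log\log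 z)^{\frac{k-1}{2}}\frac{k^3}{\log\log z}\right).$$
   Context: Sums over $n\le x$ run over natural numbers $n\geq 1$; $p$ denotes a prime. For a natural number $n$ and real $z\ge1$, $\omega_z(n):=\sum_{p\mid n,\ p\le z}1$ is the number of distinct prime divisors of $n$ not exceeding $z$. For integers $j\ge1$, $C_j:=\dfrac{\Gamma(j+1)}{2^{j/2}\Gamma(\frac j2+1)}$, and for integers $j\ge 3$, $\tilde C_j:=\dfrac{\sqrt2}{6}\dfrac{(j-1)\Gamma(\frac j2+1)}{\Gamma(\frac j2+\frac12)}C_j=\dfrac{2^{\frac{j-1}{2}}(j-1)}{3\sqrt\pi}\Gamma\left(\frac j2+1\right)$. $B:=\lim_{x\to\infty}\left(\sum_{p\le x}\frac1p-\log\log x\right)$. *)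

(* Defs.v *)
From HB Require Import structures.
From mathcomp Require Import all_boot all_order all_algebra.
From mathcomp Require Import all_classical all_reals all_analysis.

Set Implicit Arguments.
Unset Strict Implicit.
Unset Printing Implicit Defensive.

Import Order.TTheory GRing.Theory Num.Theory.
Import numFieldNormedType.Exports.

Local Open Scope classical_set_scope.
Local Open Scope ring_scope.

Definition omega {R : realType} (z : R) (n : nat) : nat :=
  (\sum_(p <- primes n | (p%:R <= z)%R) 1)%N.

Definition loglog {R : realType} (z : R) : R := ln (ln z).

(* Euler's integral; the value is meaningful for 0 < s only. *)
Definition Gamma {R : realType} (s : R) : R :=
  \int[@lebesgue_measure R]_(t in `]0, +oo[) (t `^ (s - 1) * expR (- t)).

Definition Ccst (R : realType) (j : nat) : R :=
  Gamma (j%:R + 1) / (2 `^ (j%:R / 2) * Gamma (j%:R / 2 + 1)).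

Definition Ctilde (R : realType) (j : nat) : R :=
  Num.sqrt 2 / 6
  * ((j%:R - 1) * Gamma (j%:R / 2 + 1) / Gamma (j%:R / 2 + 1 / 2))
  * Ccst R j.

(* Mertens' constant. The operator [lim] is total; the limit does exist, by
   Mertens' second theorem. *)
Definition Bcst (R : realType) : R :=
  lim ((\sum_(0 <= p < (Num.truncn x).+1 | prime p) (p%:R)^-1 - loglog x)
       @[x --> (+oo : set_system R)]).

Definition moment {R : realType} (k : nat) (z x : R) : R :=
  \sum_(1 <= n < (Num.truncn x).+1) ((omega z n)%:R - loglog z) ^+ k.

(* Main.v *)
(* Write L = loglog z. Expanding in the indicators of "p divides n", the sum over
   n <= x agrees, up to (L + pi(z))^k <= 2^k x, with x times the k-th moment of
   X - L, where X is a sum of independent Bernoulli variables of parameters 1/p,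
   p <= z. The coefficients G_n of the generating function of these moments,
   e^{-Lt} prod_p (1 + (e^t - 1)/p), satisfy
   (n+1) G_{n+1} = sum_j psi_j G_{n-j}, where psi_0 = sum_{p <= z} 1/p - L is
   close to B by Mertens' second theorem, and psi_j = L/j! + O(1) for j >= 1.
   With g_m = (L/2)^m/m!, an induction on this recurrence gives, for n^3 <= L,
   G_{2m} = g_m (1 + O(m^3/L)) and G_{2m+1} = g_m (m/3 + psi_0 + O(m^4/L)).
   All the claims follow, since k! g_m = C_k L^{k/2} if k = 2m, and
   k! g_m m/3 = C~_k L^{(k-1)/2} if k = 2m+1. *)

Require Import Defs.
From HB Require Import structures.
From mathcomp Require Import all_boot all_order all_algebra.
From mathcomp Require Import all_classical all_reals all_analysis.
From mathcomp Require Import ring lra.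
From mathcomp Require Import measurable_realfun.

Import Order.TTheory GRing.Theory Num.Theory.
Import numFieldNormedType.Exports.

Local Open Scope classical_set_scope.
Local Open Scope ring_scope.

(** * Integral and half-integral values of Gamma *)

(** The recurrence says G' = psi G, where psi is the logarithmic derivative of the generating
    function. A factor 1 + u (e^t - 1) with u = 1/p contributes coefficients u/j! + O(u^2), and the
    sum of 1/p^2 converges; hence the O(1) in psi_j. Uniformity in k is the obstacle: psi_2, psi_3,
    ... also carry the factor L, and the number of terms grows with k. What makes these terms small
    is g_{m-1} = (2m/L) g_m: two steps down in the index gain a factor 2m/L. Using this gain
    requires a priori bounds on all earlier G_i, with constants that do not grow with m. For odd k,
    Gamma at half-integers cancels from C~_k and from the term with B, and survives only in the
    scale k^{3/2} C_k of the error. Its positivity and the bound Gamma(m + 3/2) <= sqrt(m+1) m! show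
    that this scale is at least of order k k!/(2^m m!). A relative error k^4/L thus becomes k^3/L on
    that scale, and this single estimate gives the three ranges of k. *)

Lemma cvg_exprn_expRN (R : realType) (n : nat) :
  (t ^+ n * expR (- t) : R^o) @[t --> +oo%R] --> (0 : R^o).
Proof.
apply/cvgrPdist_le => /= e e0; near=> t.
have t0 : 0 < t by near: t; apply: nbhs_pinfty_gt; rewrite num_real.
have f0 : 0 < (n.+1)`!%:R :> R by rewrite ltr0n fact_gt0.
have te : (n.+1)`!%:R / e <= t.
  by near: t; apply: nbhs_pinfty_ge; rewrite num_real.
have := @expR_ge1Dxn R t n (ltW t0).
rewrite sub0r normrN ger0_norm; last by rewrite mulr_ge0 ?exprn_ge0 ?expR_ge0 ?ltW.
rewrite expRN ler_pdivrMr ?expR_gt0// => H.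
have {}H : t ^+ n.+1 / (n.+1)`!%:R <= expR t by lra.
apply: (@le_trans _ _ (e * (t ^+ n.+1 / (n.+1)`!%:R))); last by rewrite ler_pM2l.
have -> : e * (t ^+ n.+1 / (n.+1)`!%:R) = (t * e / (n.+1)`!%:R) * t ^+ n.
  by rewrite exprS; field; rewrite gt_eqF.
rewrite -[leLHS]mul1r ler_wpM2r ?exprn_ge0 ?(ltW t0)//.
by rewrite ler_pdivlMr// mul1r -ler_pdivrMr.
Unshelve. all: by end_near. Qed.

(** Integration by parts at the level of primitives: -t^(n+1) e^(-t) + (n+1) F is a primitive for
    n+1 if F is one for n. All are normalised to vanish at infinity, so the integral over the
    half-line is -F(0). *)
Lemma exprn_expRN_primitive (R : realType) (n : nat) :
  exists F : R -> R, [/\ forall t : R, is_derive t 1 F (t ^+ n * expR (- t)),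
    F t @[t --> +oo%R] --> (0 : R) & F 0 = - n`!%:R].
Proof.
elim: n => [|n [F [dF F0 F00]]].
- exists (fun t => - expR (- t)); split.
  + move=> t; apply: is_derive_eq; rewrite expr0 mul1r.
    by rewrite /GRing.scale /=; ring.
  + rewrite -oppr0; apply: cvgN.
    have := @cvg_exprn_expRN R 0; under eq_fun do rewrite expr0 mul1r. exact.
  + by rewrite oppr0 expR0.
- exists (fun t => - (t ^+ n.+1 * expR (- t)) + n.+1%:R * F t); split.
  + move=> t; have dFt := dF t.
    have d1 : is_derive t 1 (fun t : R => t ^+ n.+1 * expR (- t))
        ((n.+1)%:R * t ^+ n * expR (- t) - t ^+ n.+1 * expR (- t)).
      have de : is_derive t 1 (fun t : R => expR (- t)) (- expR (- t)).
        by apply: is_derive_eq; rewrite /GRing.scale /=; ring.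
      have dX : is_derive t 1 (fun t : R => t ^+ n.+1) (n.+1%:R * t ^+ n).
        by apply: DeriveDef; [exact: exprn_derivable|
          rewrite exp_derive /GRing.scale /= mulr1].
      have := is_deriveM dX de; rewrite mulrfctE => dXe.
      by apply: (is_derive_eq dXe); rewrite /GRing.scale /=; ring.
    have d2 : is_derive t 1 (fun t : R => n.+1%:R * F t)
        (n.+1%:R * (t ^+ n * expR (- t))) by exact: is_deriveZ.
    by apply: (is_derive_eq (is_deriveD (is_deriveN d1) d2)); ring.
  + rewrite -[X in _ --> X](_ : - 0 + n.+1%:R * 0 = 0 :> R); last by rewrite mulr0 oppr0 addr0.
    apply: cvgD; first by apply: cvgN; exact: cvg_exprn_expRN.
    by apply: cvgMr.
  + by rewrite F00 expr0n /= mul0r oppr0 add0r factS natrM mulrN.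
Qed.

Lemma integral_exprn_expRN (R : realType) (n : nat) :
  (\int[@lebesgue_measure R]_(t in `]0%R, +oo[) (t ^+ n * expR (- t))%:E
    = (n`!%:R)%:E)%E.
Proof.
have [F [dF Foo F0]] := exprn_expRN_primitive R n.
have cf : continuous (fun t : R => t ^+ n * expR (- t)).
  move=> t; apply: cvgM; first exact: exprn_continuous.
  by apply: continuous_comp; [exact: continuousN|exact: continuous_expR].
have cF : continuous F.
  by move=> t; apply/differentiable_continuous/derivable1_diffP; have [] := dF t.
rewrite integral_itv_obnd_cbnd; last first.
  apply/measurable_EFinP; apply: measurable_funTS; exact: continuous_measurable_fun.
rewrite (@ge0_continuous_FTC2y R _ F 0 0)//.
- by rewrite F0 EFinN oppeK add0e.
- by move=> t t0; rewrite mulr_ge0 ?exprn_ge0 ?expR_ge0.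
- by apply: continuous_subspaceT.
- by apply: cvg_at_right_filter; exact: cF.
- by move=> t _; rewrite derive1E; have [] := dF t.
Qed.

Lemma integrable_exprn_expRN (R : realType) (n : nat) :
  (@lebesgue_measure R).-integrable `]0, +oo[
    (EFin \o (fun t : R => t ^+ n * expR (- t))).
Proof.
have cf : continuous (fun t : R => t ^+ n * expR (- t)).
  move=> t; apply: cvgM; first exact: exprn_continuous.
  by apply: continuous_comp; [exact: continuousN|exact: continuous_expR].
apply/integrableP; split.
  by apply/measurable_EFinP; apply: measurable_funTS; exact: continuous_measurable_fun.
rewrite [X in (X < _)%E](_ : _ = (n`!%:R)%:E) ?ltry// -integral_exprn_expRN.
apply: eq_integral => t; rewrite inE/= in_itv/= andbT => t0.
by rewrite ger0_norm// mulr_ge0 ?expR_ge0 ?exprn_ge0 ?ltW.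
Qed.

Lemma Gamma_succn (R : realType) (n : nat) : Gamma (n%:R + 1 : R) = n`!%:R.
Proof.
transitivity (\int[@lebesgue_measure R]_(t in `]0, +oo[) (t ^+ n * expR (- t))).
  apply: eq_Rintegral => t; rewrite inE/= in_itv/= andbT => t0.
  by rewrite addrK powR_mulrn// ltW.
by rewrite /Rintegral integral_exprn_expRN.
Qed.

(* AM-GM for a and t / a, whose geometric mean is sqrt t; with a^2 = n + 1 it
   bounds Gamma(n + 3/2) by integral values of Gamma. *)
Lemma powR_half_bound (R : realType) (n : nat) (a t : R) : 0 < a -> 0 < t ->
  t `^ (n%:R + 2^-1) <= a / 2 * t ^+ n + (2 * a)^-1 * t ^+ n.+1.
Proof.
move=> a0 t0.
rewrite powRD; last by rewrite (gt_eqF t0) implybT.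
rewrite powR_mulrn ?(ltW t0)// powR12_sqrt ?(ltW t0)// exprS.
have -> : a / 2 * t ^+ n + (2 * a)^-1 * (t * t ^+ n)
    = t ^+ n * (a / 2 + (2 * a)^-1 * t) by ring.
rewrite ler_pM2l ?exprn_gt0//.
have s2 : Num.sqrt t ^+ 2 = t by rewrite sqr_sqrtr ?ltW.
have -> : a / 2 + (2 * a)^-1 * t =
  Num.sqrt t + (2 * a)^-1 * (Num.sqrt t - a) ^+ 2.
  by rewrite -[in LHS]s2; field; rewrite gt_eqF.
by rewrite lerDl mulr_ge0 ?sqr_ge0// invr_ge0 mulr_ge0 ?ltW.
Qed.

Lemma exprn_half_bound (R : realType) (n : nat) (a t : R) : 0 < a -> 0 < t ->
  t ^+ n.+1 <= a / 2 * t `^ (n%:R + 2^-1) + (2 * a)^-1 * t `^ (n.+1%:R + 2^-1).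
Proof.
move=> a0 t0.
have tN (r s : R) : (r + s == 0) ==> (t != 0) by rewrite (gt_eqF t0) implybT.
have -> : n.+1%:R + 2^-1 = (n%:R + 2^-1) + 1 :> R by rewrite -natr1; ring.
rewrite [X in _ + _ * X](powRD (tN _ _)) powRr1 ?(ltW t0)//.
have -> : t ^+ n.+1 = t `^ (n%:R + 2^-1) * t `^ (0%:R + 2^-1).
  rewrite -powRD// -powR_mulrn ?(ltW t0)//; congr (_ `^ _).
  by rewrite -natr1; field.
have h := powR_half_bound _ 0 a t a0 t0.
have tp : 0 <= t `^ (n%:R + 2^-1) by rewrite powR_ge0.
apply: (le_trans (ler_wpM2l tp h)); rewrite expr0 expr1 le_eqVlt; apply/orP; left.
by apply/eqP; ring.
Qed.

Lemma integrable_powR_half (R : realType) (n : nat) :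
  (@lebesgue_measure R).-integrable `]0, +oo[
    (EFin \o (fun t : R => t `^ (n%:R + 2^-1) * expR (- t))).
Proof.
have aux (t : R) : 0 < t -> t `^ (n%:R + 2^-1) <= t ^+ n + t ^+ n.+1.
  move=> t0; have h := powR_half_bound R n 1 t ltr01 t0.
  apply: (le_trans h).
  have := exprn_ge0 n (ltW t0); have := exprn_ge0 n.+1 (ltW t0); lra.
have := integrableD _ (integrable_exprn_expRN R n) (integrable_exprn_expRN R n.+1).
move=> /(_ (measurable_itv _)); apply: le_integrable => //.
  apply/measurable_EFinP; apply: measurable_funM.
    by apply: measurable_funTS; exact: measurable_powR.
  apply: measurable_funTS; apply: continuous_measurable_fun => t.
  by apply: continuous_comp; [exact: continuousN|exact: continuous_expR].
move=> t /=; rewrite in_itv/= andbT => t0.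
rewrite lee_fin !ger0_norm; last 2 first.
- by rewrite addr_ge0 // mulr_ge0 ?exprn_ge0 ?expR_ge0 ?ltW.
- by rewrite mulr_ge0 ?powR_ge0 ?expR_ge0.
rewrite -mulrDl ler_wpM2r ?expR_ge0//.
exact: aux.
Qed.

Lemma Gamma_halfE (R : realType) (n : nat) :
  Gamma (n%:R + 2^-1 + 1 : R) =
  \int[@lebesgue_measure R]_(t in `]0, +oo[) (t `^ (n%:R + 2^-1) * expR (- t)).
Proof. by rewrite /Gamma addrK. Qed.

(** The choice a^2 = n + 1 makes the two integrated terms of the AM-GM bound equal: (n+1)!/(2a) = a
    n!/2. *)
Lemma Gamma_half_le (R : realType) (n : nat) :
  Gamma (n%:R + 2^-1 + 1 : R) <= Num.sqrt n.+1%:R * n`!%:R.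
Proof.
pose a : R := Num.sqrt n.+1%:R.
have a0 : 0 < a by rewrite sqrtr_gt0 ltr0n.
have i1 := integrable_exprn_expRN R n; have i2 := integrable_exprn_expRN R n.+1.
have j1 : (@lebesgue_measure R).-integrable `]0, +oo[
    (EFin \o (fun t : R => a / 2 * (t ^+ n * expR (- t)))).
  exact: (integrableZl _ _ i1).
have j2 : (@lebesgue_measure R).-integrable `]0, +oo[
    (EFin \o (fun t : R => (2 * a)^-1 * (t ^+ n.+1 * expR (- t)))).
  exact: (integrableZl _ _ i2).
have <- : \int[@lebesgue_measure R]_(t in `]0, +oo[)
   (a / 2 * (t ^+ n * expR (- t)) + (2 * a)^-1 * (t ^+ n.+1 * expR (- t)))
   = a * n`!%:R.
  rewrite RintegralD// !RintegralZl// /Rintegral !integral_exprn_expRN /=.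
  rewrite factS natrM.
  have -> : n.+1%:R = a ^+ 2 by rewrite sqr_sqrtr// ler0n.
  by field; rewrite gt_eqF.
rewrite Gamma_halfE; apply: le_Rintegral => //.
- exact: integrable_powR_half.
- exact: (integrableD _ j1 j2).
- move=> t; rewrite /= in_itv/= andbT => t0.
  rewrite !mulrA -mulrDl ler_wpM2r ?expR_ge0//; exact: powR_half_bound.
Qed.

(* The integral could be 0 only if AM-GM, applied to t^(n+1) = t^(n+1/2) sqrt t,
   bounded (n+1)! by half of itself. *)
Lemma Gamma_half_gt0 (R : realType) (n : nat) : 0 < Gamma (n%:R + 2^-1 + 1 : R).
Proof.
have G0 m : 0 <= Gamma (m%:R + 2^-1 + 1 : R).
  by rewrite Gamma_halfE; apply: Rintegral_ge0 => t _; rewrite mulr_ge0 ?powR_ge0 ?expR_ge0.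
rewrite lt_neqAle G0 andbT; apply/eqP => G00.
pose a : R := Num.sqrt n.+2%:R.
have a0 : 0 < a by rewrite sqrtr_gt0 ltr0n.
have i1 := integrable_powR_half R n; have i2 := integrable_powR_half R n.+1.
have j1 : (@lebesgue_measure R).-integrable `]0, +oo[
    (EFin \o (fun t : R => a / 2 * (t `^ (n%:R + 2^-1) * expR (- t)))).
  exact: (integrableZl _ _ i1).
have j2 : (@lebesgue_measure R).-integrable `]0, +oo[
    (EFin \o (fun t : R => (2 * a)^-1 * (t `^ (n.+1%:R + 2^-1) * expR (- t)))).
  exact: (integrableZl _ _ i2).
have : n.+1`!%:R <= a / 2 * Gamma (n%:R + 2^-1 + 1 : R)
     + (2 * a)^-1 * Gamma (n.+1%:R + 2^-1 + 1 : R).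
  rewrite !Gamma_halfE -!RintegralZl// -RintegralD//.
  have -> : n.+1`!%:R =
      \int[@lebesgue_measure R]_(t in `]0, +oo[) (t ^+ n.+1 * expR (- t)).
    by rewrite /Rintegral integral_exprn_expRN.
  apply: le_Rintegral => //.
  - exact: integrable_exprn_expRN.
  - exact: (integrableD _ j1 j2).
  - move=> t; rewrite /= in_itv/= andbT => t0.
    rewrite !mulrA -mulrDl ler_wpM2r ?expR_ge0//; exact: exprn_half_bound.
rewrite -G00 mulr0 add0r => h.
have := Gamma_half_le R n.+1; rewrite -/a => h2.
have f0 : 0 < n.+1`!%:R :> R by rewrite ltr0n fact_gt0.
have : n.+1`!%:R <= (2 * a)^-1 * (a * n.+1`!%:R) :> R.
  by apply: le_trans h _; rewrite ler_wpM2l// invr_ge0 mulr_ge0 ?ltW.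
have -> : (2 * a)^-1 * (a * n.+1`!%:R) = n.+1`!%:R / 2 :> R.
  by field; rewrite gt_eqF.
lra.
Qed.

(** * Mertens' theorems *)

Lemma prime_sumS (V : nmodType) (F : nat -> V) (n : nat) :
  \sum_(0 <= p < n.+1 | prime p) F p =
  \sum_(0 <= p < n | prime p) F p + (if prime n then F n else 0).
Proof. by rewrite big_mkcond big_nat_recr// -big_mkcond. Qed.

(* The sum can be extended beyond n because logn p n = 0 for p > n. *)
Lemma ln_sum_logn (R : realType) (n N : nat) : (0 < n)%N -> (n <= N)%N ->
  ln n%:R = \sum_(0 <= p < N.+1 | prime p) (logn p n)%:R * ln p%:R :> R.
Proof.
move=> n0 nN; rewrite -{1}(partnT n0) (widen_partn predT nN).
have -> : (\prod_(0 <= p < N.+1 | p \in predT) p ^ logn p n =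
    \prod_(0 <= p < N.+1 | prime p) p ^ logn p n)%N.
  rewrite big_mkcond [RHS]big_mkcond; apply: eq_bigr => p _ /=.
  by case: ifP => // /negbT pp; rewrite lognE (negbTE pp).
suff [_ ->] : (0 < \prod_(0 <= p < N.+1 | prime p) p ^ logn p n)%N /\
  ln (\prod_(0 <= p < N.+1 | prime p) p ^ logn p n)%:R =
  \sum_(0 <= p < N.+1 | prime p) (logn p n)%:R * ln p%:R :> R by [].
elim/big_rec2: _ => [|p y1 y2 pp [y20 <-]]; first by rewrite ln1.
have p0 := prime_gt0 pp.
rewrite muln_gt0 expn_gt0 p0; split=> //.
by rewrite natrM lnM ?posrE ?ltr0n ?expn_gt0 ?p0// natrX lnXn ?ltr0n// mulr_natl.
Qed.

(** * Chebyshev's upper bound for the sum of ln p *)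

Lemma prime_dvd_bin_mid (m p : nat) :
  prime p -> (m.+1 < p)%N -> (p <= m.*2.+1)%N -> (p %| 'C(m.*2.+1, m))%N.
Proof.
move=> pp mp pm.
(* p divides (2m+1)! but, exceeding m+1, divides neither m! nor (m+1)!; it must then divide the
   binomial. *)
have ndvd j : (j < p)%N -> ~~ (p %| j`!)%N.
  elim: j => [_|j IH jp]; first by rewrite fact0 dvdn1 neq_ltn prime_gt1 ?orbT.
  by rewrite factS Euclid_dvdM// negb_or IH ?(ltnW jp)// gtnNdvd.
have m2 : (m <= m.*2.+1)%N by rewrite -addnn -addnS leq_addr.
have : (p %| (m.*2.+1)`!)%N by rewrite dvdn_fact// prime_gt0.
rewrite -(bin_fact m2) Euclid_dvdM// => /orP[//|].
have -> : (m.*2.+1 - m = m.+1)%N by rewrite -addnn -addnS addKn.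
by rewrite Euclid_dvdM// (negbTE (ndvd _ _)) ?(negbTE (ndvd _ mp))// ltnW.
Qed.

(** The two equal middle coefficients both occur in the row sum 2^(2m+1), so each is at most half of
    it. *)
Lemma bin_mid_le (m : nat) : ('C(m.*2.+1, m) <= 4 ^ m)%N.
Proof.
have H : (\sum_(i < m.*2.+2) 'C(m.*2.+1, i) = 2 ^ m.*2.+1)%N.
  by rewrite -[2%N]/(1 + 1)%N expnDn; apply: eq_bigr => i _; rewrite !exp1n !muln1.
have m2 : (m <= m.*2.+1)%N by rewrite -addnn -addnS leq_addr.
have E : ('C(m.*2.+1, m.+1) = 'C(m.*2.+1, m))%N.
  by rewrite -[in RHS]bin_sub//; congr binomial; rewrite -addnn -addnS addKn.
have l1 : (m < m.*2.+2)%N by rewrite ltnS.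
have l2 : (m.+1 < m.*2.+2)%N by rewrite !ltnS -addnn leq_addr.
move: H; rewrite (bigD1 (Ordinal l1))//= (bigD1 (Ordinal l2))/=; last first.
  by rewrite -val_eqE /= gtn_eqF.
have -> : (4 ^ m = 2 ^ m.*2)%N by rewrite -[4%N]/(2 ^ 2)%N -expnM mul2n.
rewrite E addnA addnn -[(_ _).*2]mul2n expnS => H.
by rewrite -(leq_pmul2l (isT : 0 < 2)%N) -H leq_addr.
Qed.

(** Erdos's argument, by strong induction. For n = 2m+1 the primes in (m+1, n] divide a binomial
    coefficient that is at most 4^m, and those up to m+1 fall under the induction hypothesis; (m+1)
    + m = n. An even n > 2 adds no prime. *)
Lemma sum_ln_prime_le (R : realType) (n : nat) :
  \sum_(0 <= p < n.+1 | prime p) ln p%:R <= n%:R * ln 4 :> R.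
Proof.
have ln_ge0n p : 0 <= ln p%:R :> R.
  by case: p => [|p]; [rewrite ln0|rewrite ln_ge0// ler1n].
have l40 : 0 <= ln 4 :> R by rewrite ln_ge0// ler1n.
elim/ltn_ind: n => n IH.
case: (posnP n) => [->|n0].
  by rewrite prime_sumS big_geq//= addr0 mul0r.
have [on|en] := boolP (odd n).
- have nE : n = (n./2).*2.+1 by rewrite -[LHS](odd_double_half n) on add1n.
  set m := n./2 in nE.
  case: (posnP m) => [m0|m0].
    by rewrite nE m0 double0 !prime_sumS big_geq//= !addr0 mul1r.
  have mn : (m.+1 < n)%N by rewrite nE ltnS -addnn -[ltnLHS]addn0 ltn_add2l.
  rewrite (@big_cat_nat _ _ _ m.+2)//=; last by rewrite ltnW.
  have step : \sum_(m.+2 <= p < n.+1 | prime p) ln p%:R <= m%:R * ln 4 :> R.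
    have C0 : (0 < 'C(n, m))%N by rewrite bin_gt0 ltnW// ltnW.
    apply: (@le_trans _ _ (ln ('C(n, m))%:R)); last first.
      rewrite mulr_natl -lnXn ?ltr0n// -natrX ler_ln ?posrE ?ltr0n ?expn_gt0//.
      by rewrite ler_nat nE; exact: bin_mid_le.
    (* The logarithm of the binomial is expanded over the primes up to a bound above both n and the
       binomial, so that the primes in (m+1, n] form a block of the sum. Each of them has exponent
       at least 1. *)
    pose N := maxn n 'C(n, m).
    rewrite (@ln_sum_logn R _ N)//; last by rewrite leq_maxr.
    rewrite [leRHS](@big_cat_nat _ _ _ m.+2)//=; last first.
      by rewrite ltnS (leq_trans (ltnW mn))// leq_maxl.
    rewrite [X in _ <= _ + X](@big_cat_nat _ _ _ n.+1)//=; last 2 first.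
    - by rewrite ltnW.
    - by rewrite ltnS leq_maxl.
    rewrite addrCA; apply: (@le_trans _ _ (\sum_(m.+2 <= p < n.+1 | prime p)
        (logn p 'C(n, m))%:R * ln p%:R)).
      rewrite big_nat_cond [leRHS]big_nat_cond; apply: ler_sum => p /andP[/andP[p1 p2] pp].
      rewrite -[leLHS]mul1r ler_wpM2r// ler1n logn_gt0 mem_primes pp C0.
      by rewrite nE prime_dvd_bin_mid// -?nE.
    by rewrite lerDl addr_ge0// sumr_ge0// => p _; rewrite mulr_ge0.
  apply: (le_trans (lerD (IH _ mn) step)).
  by rewrite -mulrDl -natrD nE addSn addnn.
- case: n => [//|n] in n0 en IH *.
  rewrite prime_sumS.
  have IHn := IH _ (ltnSn n).
  case: ifP => [pn|_]; last first.
    by rewrite addr0; apply: le_trans IHn _; rewrite ler_wpM2r// ler_nat.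
  have : n.+1 = 2 by case/even_prime: pn => // on; rewrite on in en.
  move=> [->]; rewrite !prime_sumS big_geq//= !add0r.
  by rewrite mulr_natl; apply: (@le_trans _ _ (ln 4));
    rewrite ?ler_ln ?posrE ?ltr0n ?ler_nat// mulr2n lerDl.
Qed.

(** * Mertens' first theorem, from two evaluations of ln n! *)

Lemma lnS_le (R : realType) (n : nat) : (0 < n)%N ->
  ln n.+1%:R <= ln n%:R + n%:R^-1 :> R.
Proof.
move=> n0; have n0R : 0 < n%:R :> R by rewrite ltr0n.
have -> : n.+1%:R = n%:R * (1 + n%:R^-1) :> R.
  by rewrite -natr1; field; rewrite gt_eqF.
have i0 : 0 < n%:R^-1 :> R by rewrite invr_gt0.
rewrite lnM ?posrE//.
by rewrite lerD2l le_ln1Dx// (lt_trans _ i0)// ltrN10.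
Qed.

Lemma ln_fact_le (R : realType) (n : nat) : ln n`!%:R <= n%:R * ln n%:R :> R.
Proof.
elim: n => [|n IH]; first by rewrite fact0 ln1 mul0r.
rewrite factS natrM lnM ?posrE ?ltr0n ?fact_gt0// -natr1 mulrDl mul1r addrC lerD2r.
apply: (le_trans IH); case: n {IH} => [|n]; first by rewrite !mul0r.
by rewrite ler_wpM2l// ler_ln ?posrE ?ltr0n// natr1 ler_nat.
Qed.

Lemma ln_fact_ge (R : realType) (n : nat) :
  n%:R * ln n%:R - n%:R <= ln n`!%:R :> R.
Proof.
elim: n => [|n IH]; first by rewrite fact0 ln1 mul0r subr0.
rewrite factS natrM lnM ?posrE ?ltr0n ?fact_gt0//.
case: (posnP n) => [->|n0]; first by rewrite fact0 ln1 mul1r addr0 lerBlDr lerDl.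
have n0R : 0 < n%:R :> R by rewrite ltr0n.
have h := ler_wpM2l (ltW n0R) (lnS_le R _ n0).
rewrite mulrDr divff ?gt_eqF// in h.
by move: IH h; set a := ln n.+1%:R; rewrite -natr1 mulrDl; lra.
Qed.

Lemma logn_fact_small (n p : nat) : prime p -> (n < p)%N -> logn p n`! = 0%N.
Proof.
move=> pp np; rewrite logn_fact// big_nat_cond big1// => k /andP[/andP[k1 _] _].
rewrite divn_small// (leq_trans np)// -[X in (X <= _)%N]expn1.
by rewrite leq_exp2l// prime_gt1.
Qed.

Lemma logn_fact_ge (R : realType) (n p : nat) : prime p -> (p <= n)%N ->
  n%:R / p%:R - 1 <= (logn p n`!)%:R :> R.
Proof.
move=> pp pn; rewrite logn_fact//.
have p0 : 0 < p%:R :> R by rewrite ltr0n prime_gt0.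
rewrite big_nat_recl ?(leq_trans (prime_gt0 pp))// expn1.
apply: (@le_trans _ _ (n %/ p)%:R); last by rewrite ler_nat leq_addr.
rewrite lerBlDr ler_pdivrMr// natr1 -natrM ler_nat ltnW//.
by rewrite ltn_ceil// prime_gt0.
Qed.

Lemma logn_fact_le (R : realType) (n p : nat) : prime p ->
  (logn p n`!)%:R <= n%:R / (p%:R - 1) :> R.
Proof.
move=> pp; rewrite logn_fact//.
have p1 : 1 < p%:R :> R by rewrite ltr1n prime_gt1.
(* Bounding by the exact geometric partial sum lets the induction on the number of terms of
   Legendre's formula close. *)
have H m : (\sum_(1 <= k < m.+1) n %/ p ^ k)%:R <=
    n%:R / (p%:R - 1) * (1 - (p%:R ^+ m)^-1) :> R.
  elim: m => [|m IH]; first by rewrite big_geq// expr0 invr1 subrr mulr0.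
  rewrite big_nat_recr//= natrD.
  have q0 : 0 < p%:R ^+ m.+1 :> R by rewrite exprn_gt0//; lra.
  have d : (n %/ p ^ m.+1)%:R <= n%:R / p%:R ^+ m.+1 :> R.
    by rewrite ler_pdivlMr// -natrX -natrM ler_nat leq_divM.
  apply: (le_trans (lerD IH d)); rewrite le_eqVlt; apply/orP; left.
  have m0 : 0 < p%:R ^+ m :> R by rewrite exprn_gt0//; lra.
  by apply/eqP; rewrite exprS; field; rewrite subr_eq0 !gt_eqF//; lra.
apply: (le_trans (H n)); apply: ler_piMr.
  by rewrite mulr_ge0// invr_ge0; lra.
by rewrite gerBl invr_ge0 exprn_ge0.
Qed.

Lemma ln_fact_sum (R : realType) (n : nat) :
  ln n`!%:R = \sum_(0 <= p < n.+1 | prime p) (logn p n`!)%:R * ln p%:R :> R.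
Proof.
rewrite (@ln_sum_logn R _ (maxn n n`!)) ?fact_gt0 ?leq_maxr//.
rewrite (@big_cat_nat _ _ _ n.+1)//=; last by rewrite ltnS leq_maxl.
rewrite [X in _ + X]big_nat_cond [X in _ + X]big1 ?addr0// => p /andP[/andP[np _] pp].
by rewrite logn_fact_small ?mul0r.
Qed.

Lemma sum_ln_prime_pred_le (R : realType) (n : nat) :
  \sum_(0 <= p < n.+1 | prime p) ln p%:R / (p%:R * (p%:R - 1)) <= 2 :> R.
Proof.
case: n => [|n]; first by rewrite prime_sumS big_geq//= addr0.
(* With F(t) = (ln t + 2)/t, the term ln N / (N (N-1)) is at most F(N-1) - F(N) for every integer N
   >= 2, and F(1) = 2 is the bound. *)
suff : \sum_(0 <= p < n.+2 | prime p) ln p%:R / (p%:R * (p%:R - 1)) <=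
    2 - (ln n.+1%:R + 2) / n.+1%:R :> R.
  have : 0 <= (ln n.+1%:R + 2) / n.+1%:R :> R.
    by rewrite divr_ge0// addr_ge0// ln_ge0// ler1n.
  by move=> h /le_trans; apply; rewrite gerBl.
elim: n => [|n IH]; first by rewrite !prime_sumS big_geq//= ln1; lra.
rewrite prime_sumS.
have l0 : 0 <= ln n.+2%:R :> R by rewrite ln_ge0// ler1n.
have key : ln n.+2%:R / (n.+2%:R * (n.+2%:R - 1)) <=
   (ln n.+1%:R + 2) / n.+1%:R - (ln n.+2%:R + 2) / n.+2%:R :> R.
  have := lnS_le R _ (ltn0Sn n).
  have m1 : 1 <= n.+1%:R :> R by rewrite ler1n.
  move: (ln n.+2%:R) (ln n.+1%:R) => b a.
  rewrite -[n.+2%:R]natr1 addrK; move: n.+1%:R m1 => m m1 h.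
  have m0 : 0 < m by lra.
  rewrite -subr_ge0.
  have -> : (a + 2) / m - (b + 2) / (m + 1) - b / ((m + 1) * m) =
     ((m + 1) * (a - b) + 2) / ((m + 1) * m).
    by field; rewrite !gt_eqF//; lra.
  apply: divr_ge0; last by rewrite mulr_ge0; lra.
  have mi : m * m^-1 = 1 by rewrite divff// gt_eqF.
  have i1 : m^-1 <= 1 by rewrite invf_le1.
  have h2 : (m + 1) * (b - a) <= (m + 1) * m^-1 by rewrite ler_wpM2l; lra.
  have h3 : (m + 1) * m^-1 = 1 + m^-1 by rewrite mulrDl mi mul1r.
  rewrite h3 in h2; lra.
have t0 : 0 <= ln n.+2%:R / (n.+2%:R * (n.+2%:R - 1)) :> R.
  by rewrite divr_ge0// mulr_ge0// subr_ge0 ler1n.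
move: t0 key IH; move: (ln n.+2%:R / _) ((ln n.+1%:R + 2) / _) => T F1.
move: ((ln n.+2%:R + 2) / _) => F2.
by case: ifP => _; lra.
Qed.

(** ln n! is n ln n up to O(n) and, by Legendre's formula, n times the sum of ln p / p up to O(n).
    The total error is n ln 4 <= 3n on one side, from Chebyshev's bound, and n + 2n on the other. *)
Lemma mertens1 (R : realType) (n : nat) : (0 < n)%N ->
  `|\sum_(0 <= p < n.+1 | prime p) ln p%:R / p%:R - ln n%:R| <= 3 :> R.
Proof.
move=> n0; have n0R : 0 < n%:R :> R by rewrite ltr0n.
have lnp (p : nat) : prime p -> 0 <= ln p%:R :> R.
  by move=> /prime_gt0 p0; rewrite ln_ge0// ler1n.
set A := \sum_(0 <= p < n.+1 | prime p) ln p%:R / p%:R.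
have up : n%:R * A <= n%:R * ln n%:R + n%:R * ln 4.
  rewrite -lerBlDr; apply: le_trans (ln_fact_le R n); rewrite ln_fact_sum.
  rewrite lerBlDr; apply: le_trans (lerD (lexx _) (sum_ln_prime_le R n)).
  rewrite -big_split/= /A big_distrr/= big_nat_cond [leRHS]big_nat_cond.
  apply: ler_sum => p /andP[/andP[_ pn] pp].
  have := ler_wpM2r (lnp _ pp) (logn_fact_ge R n p pp pn).
  by rewrite mulrBl mul1r lerBlDr mulrA mulrAC.
have lo : n%:R * ln n%:R - n%:R <= n%:R * A + n%:R * 2.
  apply: (le_trans (ln_fact_ge R n)); rewrite ln_fact_sum.
  apply: le_trans (lerD (lexx _) (ler_wpM2l (ltW n0R) (sum_ln_prime_pred_le R n))).
  rewrite /A !big_distrr/= -big_split/= big_nat_cond [leRHS]big_nat_cond.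
  apply: ler_sum => p /andP[/andP[_ pn] pp].
  have p1 : 1 < p%:R :> R by rewrite ltr1n prime_gt1.
  apply: (le_trans (ler_wpM2r (lnp _ pp) (logn_fact_le R n p pp))).
  rewrite le_eqVlt; apply/orP; left; apply/eqP; field.
  by rewrite subr_eq0 !gt_eqF//; lra.
have l43 : ln 4 <= 3 :> R by have := @le_ln1Dx R 3; rewrite (_ : 1 + 3 = 4); [apply; lra|ring].
rewrite -mulrDr ler_pM2l// in up.
rewrite -mulrDr -[X in _ - X]mulr1 -mulrBr ler_pM2l// in lo.
by rewrite ler_norml; apply/andP; split; lra.
Qed.

Lemma ln_sub_bounds (R : realType) (a b : R) : 0 < a -> a <= b ->
  (b - a) / b <= ln b - ln a <= (b - a) / a.
Proof.
move=> a0 ab; have b0 : 0 < b by lra.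
have aV : a * a^-1 = 1 by rewrite divff// gt_eqF.
have bV : b * b^-1 = 1 by rewrite divff// gt_eqF.
have r0 : 0 < b / a by rewrite divr_gt0.
have r1 : 0 < a / b by rewrite divr_gt0.
have h1 : ln (1 + (b / a - 1)) <= b / a - 1 by apply: le_ln1Dx; lra.
have h2 : ln (1 + (a / b - 1)) <= a / b - 1 by apply: le_ln1Dx; lra.
rewrite addrC subrK ln_div ?posrE// in h1.
rewrite addrC subrK ln_div ?posrE// in h2.
by rewrite !mulrBl aV bV; apply/andP; split; lra.
Qed.

(** * Mertens' second theorem, with a rate *)

Section Mertens2.
Variable R : realType.

Let A (n : nat) : R := \sum_(0 <= p < n.+1 | prime p) ln p%:R / p%:R.
(* Abel summation in telescoped form: the increments of V are at most
   4 (1/ln n - 1/ln (n+1)). *)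
Let V (n : nat) : R := \sum_(0 <= p < n.+1 | prime p) (p%:R)^-1 - ln (ln n%:R)
  - (A n - ln n%:R) / ln n%:R.

Let ln_nat_gt0 (n : nat) : (2 <= n)%N -> 0 < ln n%:R :> R.
Proof. by move=> n2; rewrite ln_gt0// ltr1n. Qed.

Let V_step (n : nat) : (2 <= n)%N ->
  `|V n.+1 - V n| <= 4 * ((ln n%:R)^-1 - (ln n.+1%:R)^-1).
Proof.
move=> n2; have l0 := ln_nat_gt0 _ n2; have l0' := ln_nat_gt0 _ (leqW n2).
have n0 : (0 < n)%N by apply: leq_trans n2.
have lS := lnS_le R _ n0.
have nV : n%:R^-1 <= 1 :> R by rewrite invf_le1 ?ler1n ?ltr0n.
have ll : ln n%:R <= ln n.+1%:R :> R by rewrite ler_ln ?posrE ?ltr0n// ler_nat.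
have := mertens1 R _ n0; rewrite -/(A n) => M.
have [b1 b2] := andP (ln_sub_bounds _ _ _ l0 ll).
pose c : R := if prime n.+1 then n.+1%:R^-1 else 0.
have SE : \sum_(0 <= p < n.+2 | prime p) (p%:R)^-1 =
    \sum_(0 <= p < n.+1 | prime p) (p%:R)^-1 + c by rewrite prime_sumS.
have AE : A n.+1 = A n + ln n.+1%:R * c.
  by rewrite /A prime_sumS /c; case: ifP => _; rewrite ?mulr0.
rewrite /V AE SE {SE AE}.
move: (\sum_(0 <= p < n.+1 | _) _) => S.
have d1 : ln n.+1%:R - ln n%:R <= 1 :> R.
  by rewrite lerBlDr addrC; apply: (le_trans lS); rewrite lerD2l.
move: (A n) {lS nV} c (ln n.+1%:R) (ln n%:R) l0 l0' ll M b1 b2 d1 => An c l' l l0 l0' ll M b1 b2 d1.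
(* If n+1 is prime, the changes of the two prime sums cancel. What remains is the increment of 1/ln
   times the bounded quantity [A n - ln n], and the second-order error of ln ln. *)
have -> : S + c - ln l' - (An + l' * c - l') / l' - (S - ln l - (An - l) / l) =
   (An - l) * (l^-1 - l'^-1) - ((ln l' - ln l) - (l' - l) / l').
  by field; rewrite !gt_eqF.
have iV : 0 <= l^-1 - l'^-1 by rewrite subr_ge0 lef_pV2.
have e1 : `|(An - l) * (l^-1 - l'^-1)| <= 3 * (l^-1 - l'^-1).
  by rewrite normrM (ger0_norm iV) ler_wpM2r.
have e2 : `|(ln l' - ln l) - (l' - l) / l'| <= l^-1 - l'^-1.
  rewrite ger0_norm; last by rewrite subr_ge0.
  apply: (@le_trans _ _ ((l' - l) * (l^-1 - l'^-1))).
    by rewrite mulrBr; lra.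
  by rewrite ler_piMl.
by apply: (le_trans (ler_normB _ _)); lra.
Qed.

Let U_le (m n : nat) : (2 <= m)%N -> (m <= n)%N ->
  V n + 4 / ln n%:R <= V m + 4 / ln m%:R /\
  V m - 4 / ln m%:R <= V n - 4 / ln n%:R.
Proof.
move=> m2; elim: n => [|n IH]; first by rewrite leqn0 => /eqP m0; rewrite m0 in m2.
rewrite leq_eqVlt => /orP[/eqP <-//|mn].
have [h1 h2] := IH mn.
have := V_step _ (leq_trans m2 mn); rewrite ler_norml => /andP[].
move: h1 h2; move: (ln n%:R)^-1 (ln m%:R)^-1 (ln n.+1%:R)^-1 (V n.+1) (V n) (V m).
move=> a b c d e f ? ? ? ?; split; lra.
Qed.

(** The intervals [V n - 4/ln n, V n + 4/ln n] are nested by [U_le], so the supremum of the left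
    endpoints lies in all of them. This yields the limit together with its rate. *)
Let V_cvg : exists B : R, forall n, (2 <= n)%N -> `|V n - B| <= 4 / ln n%:R.
Proof.
pose E := [set V n - 4 / ln n%:R | n in [set n | (2 <= n)%N]].
have WU m n : (2 <= m)%N -> (2 <= n)%N -> V m - 4 / ln m%:R <= V n + 4 / ln n%:R.
  move=> m2 n2; have [mn|/ltnW nm] := leqP m n.
    have [_ h] := U_le _ _ m2 mn; apply: (le_trans h).
    have : 0 <= 4 / ln n%:R :> R by rewrite divr_ge0// ltW// ln_nat_gt0.
    by move: (4 / _) => c; lra.
  have [h _] := U_le _ _ n2 nm; apply: le_trans h.
  have : 0 <= 4 / ln m%:R :> R by rewrite divr_ge0// ltW// ln_nat_gt0.
  by move: (4 / _) => c; lra.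
exists (sup E) => n n2.
have ub : has_ubound E.
  by exists (V 2 + 4 / ln 2%:R) => _ [m m2 <-]; exact: WU.
have h1 : V n - 4 / ln n%:R <= sup E by apply: ub_le_sup => //; exists n.
have h2 : sup E <= V n + 4 / ln n%:R.
  apply: ge_sup; first by exists (V n - 4 / ln n%:R); exists n.
  by move=> _ [m m2 <-]; exact: WU.
by rewrite ler_norml; move: h1 h2; move: (4 / _) => c h1 h2; apply/andP; split; lra.
Qed.

Let s (x : R) : R :=
  \sum_(0 <= p < (Num.truncn x).+1 | prime p) (p%:R)^-1 - loglog x.

(** With n the integer part of x, both s x - V n and V n - B cost 4 / ln n, and ln x <= 2 ln n
    because x < n + 1 <= n^2; hence 16. *)
Let s_cvg : exists B : R, forall x, 2 <= x -> `|s x - B| <= 16 / ln x.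
Proof.
have [B HB] := V_cvg; exists B => x x2.
have x0 : 0 <= x by lra.
pose n := Num.truncn x.
have n2 : (2 <= n)%N by rewrite truncn_ge_nat.
have n0 : (0 < n)%N by apply: leq_trans n2.
have [nx xn] := andP (truncn_itv x0); rewrite -/n in nx xn.
have l0 := ln_nat_gt0 _ n2.
have n0R : 0 < n%:R :> R by rewrite ltr0n.
have lx : ln n%:R <= ln x by rewrite ler_ln ?posrE//; lra.
have h1 : ln x <= ln n%:R + 1.
  have : ln x <= ln n.+1%:R by rewrite ler_ln ?posrE ?ltr0n// ?ltW//; lra.
  move=> /le_trans; apply; apply: (le_trans (lnS_le R _ n0)).
  by rewrite lerD2l invf_le1 ?ler1n.
have h2 : ln x <= 2 * ln n%:R.
  rewrite mulr_natl -lnXn// ler_ln ?posrE ?exprn_gt0//; last by lra.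
  apply: (le_trans (ltW xn)); rewrite -natrX ler_nat.
  by rewrite -mulnn (leq_trans (_ : n.+1 <= n * 2)%N) ?leq_pmul2l//
    muln2 -addnn -[X in (X <= _)%N]addn1 leq_add2l.
have lnn : (ln n%:R)^-1 <= 2 / ln x.
  by rewrite ler_pdivlMr; [rewrite mulrC ler_pdivrMr|lra].
have h3 : `|s x - V n| <= 4 * (ln n%:R)^-1.
  have := mertens1 R _ n0; rewrite -/(A n) => M.
  have [b1 b2] := andP (ln_sub_bounds _ _ _ l0 lx).
  have -> : s x - V n = - (ln (ln x) - ln (ln n%:R)) + (A n - ln n%:R) / ln n%:R.
    by rewrite /s /V /loglog -/n; ring.
  have e1 : `|(A n - ln n%:R) / ln n%:R| <= 3 * (ln n%:R)^-1.
    have i0 : 0 <= (ln n%:R)^-1 :> R by rewrite invr_ge0 ltW.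
    by rewrite normrM (ger0_norm i0) ler_wpM2r.
  have e2 : `|- (ln (ln x) - ln (ln n%:R))| <= (ln n%:R)^-1.
    rewrite normrN ger0_norm; last first.
      by apply: le_trans b1; rewrite divr_ge0; lra.
    apply: (le_trans b2); rewrite ler_piMl ?invr_ge0 ?(ltW l0)//; lra.
  apply: (le_trans (ler_normD _ _)); move: e1 e2; move: (ln n%:R)^-1 => c; lra.
have h4 := HB _ n2.
have -> : s x - B = (s x - V n) + (V n - B) by ring.
apply: (le_trans (ler_normD _ _)).
move: h3 h4 lnn; move: (ln n%:R)^-1 (ln x)^-1 => c d; lra.
Qed.

Lemma mertens2 (x : R) : 2 <= x ->
  `|\sum_(0 <= p < (Num.truncn x).+1 | prime p) (p%:R)^-1 - loglog x - Bcst R|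
  <= 16 / ln x.
Proof.
have [B HB] := s_cvg.
(* The rate proves convergence, so the total operator in [Bcst] does return B. *)
suff -> : Bcst R = B by exact: HB.
rewrite /Bcst; apply: cvg_lim; first exact: norm_hausdorff.
apply/cvgrPdist_le => /= e e0; near=> y.
have y2 : 2 <= y by near: y; apply: nbhs_pinfty_ge; rewrite num_real.
have ye : expR (16 / e) <= y by near: y; apply: nbhs_pinfty_ge; rewrite num_real.
rewrite distrC; apply: (le_trans (HB y y2)).
have ly : 16 / e <= ln y by rewrite -[leLHS]expRK ler_ln ?posrE ?expR_gt0//; lra.
rewrite ler_pdivrMr; first by rewrite mulrC -ler_pdivrMr.
by apply: lt_le_trans ly; rewrite divr_gt0.
Unshelve. all: by end_near. Qed.

End Mertens2.

(** * Asymptotics of a recurrence *)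

Section Recurrence.
Variables (R : realType) (A L : R) (psi G : nat -> R).
Hypotheses (A1 : 1 <= A) (L1 : 1 <= L) (G0 : G 0 = 1).
Hypothesis G_rec : forall n,
  n.+1%:R * G n.+1 = \sum_(0 <= i < n.+1) psi (n - i) * G i.
Hypothesis psi0 : `|psi 0| <= A.
Hypothesis psi_near : forall j, (0 < j)%N -> `|psi j - L / j`!%:R| <= A.

Let g (m : nat) : R := (L / 2) ^+ m / m`!%:R.
Let c : R := A + 1.
(** With u = c (m+1), the lower-order terms A u + A + 4 u^2 of an even step stay below 10 u^2 = q
    (m+1)^2; the odd step reuses this room. *)
Let q : R := 10 * c ^+ 2.
(* The crude bounds |G_{2i}| <= Y_m g_i and |G_{2i+1}| <= c (i+1) Y_m g_i for i <= m
   are propagated by a Gronwall argument: Y absorbs the relative loss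
   q (m+1)^2 / L of each step and stays bounded as long as 8 m^3 <= L. *)
Let Y (m : nat) : R := expR (q * m%:R ^+ 3 / L).
Let Q : R := expR q.
(** The weight i + 2 adds the 1 and the i + 1 of the crude bounds on G_{2i} and G_{2i+1}. *)
Let Z (m : nat) : R := \sum_(0 <= i < m) i.+2%:R * g i.

Let L0 : 0 < L. Proof. by apply: lt_le_trans L1. Qed.

Let g_gt0 m : 0 < g m.
Proof. by rewrite divr_gt0 ?ltr0n ?fact_gt0// exprn_gt0// divr_gt0. Qed.

Let gS m : 2 * m.+1%:R * g m.+1 = L * g m.
Proof.
rewrite /g exprS factS natrM; field.
by rewrite nat1r !pnatr_eq0 -lt0n fact_gt0.
Qed.

Let cube_mono (m : nat) : 8 * m.+1%:R ^+ 3 <= L -> 8 * m%:R ^+ 3 <= L.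
Proof.
apply: le_trans; rewrite ler_pM2l// lerXn2r ?nnegrE ?ler0n//.
by rewrite ler_nat.
Qed.

(** The g_i grow so fast that the last term of [Z m] dominates: L (m+1) g_{m-1} = 2m (m+1) g_m. The
    earlier ones are absorbed because 4m <= L. *)
Let Z_le m : 8 * m%:R ^+ 3 <= L -> L * Z m <= 4 * m.+1%:R ^+ 2 * g m.
Proof.
elim: m => [|m IH] mL.
  by rewrite /Z big_geq// mulr0 mulr_ge0 ?mulr_ge0// ltW.
have {}IH := IH (cube_mono _ mL).
rewrite /Z big_nat_recr//= -/(Z m) mulrDr.
have M1 : 1 <= m.+1%:R :> R by rewrite ler1n.
have E : 4 * m.+2%:R ^+ 2 * g m.+1 = 2 * m.+2%:R ^+ 2 / m.+1%:R * (L * g m).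
  by rewrite -gS; field; rewrite nat1r pnatr_eq0.
rewrite E; move: mL M1 IH (g_gt0 m); rewrite -[m.+2%:R]natr1.
move: m.+1%:R (g m) (Z m) => M h z mL M1 IH h0.
have M0 : 0 < M by lra.
have h1 : 4 * M <= L.
  have : 1 <= M ^+ 2 by rewrite exprn_ege1.
  have := mL; rewrite exprSr; nra.
apply: (@le_trans _ _ (M * h * L + L * ((M + 1) * h))).
  rewrite lerD2r; apply: (le_trans IH).
  have : 4 * M * (M * h) <= L * (M * h) by apply: ler_wpM2r h1; apply: mulr_ge0; exact: ltW.
  by rewrite expr2; lra.
have -> : 2 * (M + 1) ^+ 2 / M * (L * h) =
   M * h * L + L * ((M + 1) * h) + (3 + 2 / M) * (L * h).
  by field; rewrite gt_eqF.
rewrite lerDl; apply: mulr_ge0; last by apply: mulr_ge0; exact: ltW.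
have : 0 < 2 / M by rewrite divr_gt0.
lra.
Qed.

Let psi_le j : (0 < j)%N -> `|psi j| <= c * L.
Proof.
move=> j0; rewrite -[psi j](subrK (L / j`!%:R)).
apply: (le_trans (ler_normD _ _)).
have h : `|L / j`!%:R| <= L.
  rewrite ger0_norm; last by rewrite divr_ge0// ltW.
  rewrite ler_pdivrMr ?ltr0n ?fact_gt0//.
  by apply: ler_peMr; [exact: ltW|rewrite ler1n fact_gt0].
apply: (le_trans (lerD (psi_near _ j0) h)); rewrite /c mulrDl mul1r lerD2r.
by apply: ler_peMr => //; exact: le_trans A1.
Qed.

Let c2 : 2 <= c. Proof. rewrite /c; move: A1; lra. Qed.
Let c0 : 0 <= c. Proof. by move: c2; lra. Qed.

Let Y1 m : 1 <= Y m.
Proof.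
rewrite -expR0 ler_expR divr_ge0 ?(ltW L0)// mulr_ge0 ?exprn_ge0//.
by rewrite mulr_ge0// exprn_ge0.
Qed.

(** e^t >= 1 + t, applied to the increment of the exponent, together with (m+1)^3 - m^3 >=
    (m+1)^2. *)
Let Y_step m : Y m * (L + q * m.+1%:R ^+ 2) <= Y m.+1 * L.
Proof.
have q0 : 0 <= q by rewrite mulr_ge0// exprn_ge0.
have -> : Y m.+1 = Y m * expR (q * (3 * m%:R ^+ 2 + 3 * m%:R + 1) / L).
  rewrite /Y -expRD; congr expR; rewrite -natr1; field; exact: lt0r_neq0.
rewrite -mulrA ler_pM2l ?expR_gt0//.
apply: le_trans (ler_wpM2r (ltW L0) (expR_ge1Dx _)).
rewrite mulrDl mul1r divfK ?lt0r_neq0// lerD2l ler_wpM2l// -natr1.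
have : 0 <= m%:R :> R by []. nra.
Qed.

Let Y_mono m : Y m <= Y m.+1.
Proof.
rewrite -(ler_pM2r L0); apply: le_trans (Y_step m).
rewrite ler_wpM2l ?(le_trans _ (Y1 m))// lerDl mulr_ge0 ?exprn_ge0//.
by rewrite mulr_ge0// exprn_ge0.
Qed.

Let Y_leQ m : 8 * m%:R ^+ 3 <= L -> Y m <= Q.
Proof.
move=> mL; rewrite ler_expR ler_pdivrMr// ler_wpM2l//.
  by rewrite mulr_ge0// exprn_ge0.
have : 0 <= m%:R ^+ 3 :> R by rewrite exprn_ge0. lra.
Qed.

(** * A priori bounds on G *)

Let crude (m : nat) (y : R) := forall i, (i < m)%N ->
  `|G i.*2| <= y * g i /\ `|G i.*2.+1| <= c * i.+1%:R * y * g i.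

Let sum_absG_le m y : 0 <= y -> crude m y ->
  \sum_(0 <= i < m.*2) `|G i| <= c * y * Z m.
Proof.
move=> y0; elim: m => [|m IH] cr; first by rewrite /Z !big_geq// mulr0.
rewrite doubleS !big_nat_recr//= /Z big_nat_recr//= -/(Z m) mulrDr -addrA.
apply: lerD; first by apply: IH => i im; apply: cr; rewrite leqW.
have [h1 h2] := cr m (ltnSn m); apply: (le_trans (lerD h1 h2)).
have -> : c * y * (m.+2%:R * g m) = c * y * g m + c * m.+1%:R * y * g m.
  by rewrite -[m.+2%:R]natr1; ring.
rewrite lerD2r -mulrA; apply: ler_peMl; first by rewrite mulr_ge0// ltW.
by move: c2; lra.
Qed.

(** The size c L of psi_j is enough information here: the G_i with i < 2m sum to O(m^2 g_m / L) by
    [Z_le], and L cancels. *)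
Let tail_le m y N : (m.*2 <= N)%N -> 8 * m%:R ^+ 3 <= L -> 0 <= y -> crude m y ->
  `|\sum_(0 <= i < m.*2) psi (N - i) * G i| <= 4 * c ^+ 2 * y * m.+1%:R ^+ 2 * g m.
Proof.
move=> mN mL y0 cr; apply: (le_trans (ler_norm_sum _ _ _)).
apply: (@le_trans _ _ (\sum_(0 <= i < m.*2) c * L * `|G i|)).
  rewrite big_nat_cond [leRHS]big_nat_cond; apply: ler_sum => i /andP[/andP[_ im] _].
  by rewrite normrM ler_wpM2r// psi_le// subn_gt0 (leq_trans im).
rewrite -big_distrr/=.
apply: (@le_trans _ _ (c * L * (c * y * Z m))).
  by rewrite ler_wpM2l ?sum_absG_le// mulr_ge0// ltW.
have -> : c * L * (c * y * Z m) = c ^+ 2 * y * (L * Z m) by ring.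
have -> : 4 * c ^+ 2 * y * m.+1%:R ^+ 2 * g m = c ^+ 2 * y * (4 * m.+1%:R ^+ 2 * g m) by ring.
by rewrite ler_wpM2l ?Z_le// mulr_ge0// exprn_ge0.
Qed.

Let G_even_rec m : 2 * m.+1%:R * G m.+1.*2 = psi 0 * G m.*2.+1 + psi 1 * G m.*2
   + \sum_(0 <= i < m.*2) psi (m.*2.+1 - i) * G i.
Proof.
have e : m.*2.+2%:R = 2 * m.+1%:R :> R by rewrite -doubleS -mul2n natrM.
have := G_rec m.*2.+1; rewrite e doubleS => ->.
rewrite !big_nat_recr//= subnn subSnn; ring.
Qed.

Let G_odd_rec m : (2 * m.+1%:R + 1) * G m.+1.*2.+1 = psi 0 * G m.+1.*2
   + psi 1 * G m.*2.+1 + psi 2 * G m.*2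
   + \sum_(0 <= i < m.*2) psi (m.+1.*2 - i) * G i.
Proof.
have e : m.+1.*2.+1%:R = 2 * m.+1%:R + 1 :> R by rewrite -natr1 -mul2n natrM.
have := G_rec m.+1.*2; rewrite e => ->.
rewrite doubleS !big_nat_recr//= subnn subSnn (_ : m.*2.+2 - m.*2 = 2)%N; first ring.
by rewrite -[m.*2.+2]addn2 addKn.
Qed.

Let G1 : G 1 = psi 0.
Proof. by have := G_rec 0; rewrite big_nat1 subnn G0 mul1r mulr1. Qed.

(** In the even step psi_1 G_{2m} brings L g_m = 2(m+1) g_{m+1}, the expected growth. The other
    terms are O(u^2) g_m with u = c (m+1), and the growth of [Y] pays for them. *)
Let crude_Y m : 8 * m%:R ^+ 3 <= L -> crude m.+1 (Y m).
Proof.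
have A0 : 0 <= A by move: A1; lra.
elim: m => [|m IH] mL.
  move=> i; rewrite ltnS leqn0 => /eqP ->; rewrite /= G0 G1 normr1.
  have -> : g 0 = 1 by rewrite /g expr0 fact0 divr1.
  rewrite !mulr1; split=> //.
  apply: (le_trans psi0); have := Y1 0; move: A1; rewrite /c; nra.
have mL' := cube_mono _ mL.
have {}IH := IH mL'.
have y0 : 0 <= Y m by rewrite expR_ge0.
have y0' : 0 <= Y m.+1 by rewrite expR_ge0.
move=> i; rewrite ltnS leq_eqVlt => /orP[/eqP ->{i}|im]; last first.
  have [h1 h2] := IH i im; have gi := ltW (g_gt0 i); split.
    by apply: (le_trans h1); rewrite ler_wpM2r.
  by apply: (le_trans h2); rewrite ler_wpM2r// ler_wpM2l// mulr_ge0.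
have cr : crude m (Y m) by move=> i im; apply: IH; rewrite leqW.
have [h1 h2] := IH m (ltnSn m).
have M1 : 1 <= m.+1%:R :> R by rewrite ler1n.
have gm := ltW (g_gt0 m); have gm' := ltW (g_gt0 m.+1).
have p1 : `|psi 1| <= L + A.
  have := psi_near 1 isT; rewrite divr1 => h.
  rewrite -[psi 1](subrK L); apply: (le_trans (ler_normD _ _)).
  by rewrite (ger0_norm (ltW L0)) addrC lerD2l.
have p2 : `|psi 2| <= L / 2 + A.
  have := psi_near 2 isT; rewrite [2`!]/= => h.
  rewrite -[psi 2](subrK (L / 2)); apply: (le_trans (ler_normD _ _)).
  by rewrite (@ger0_norm _ (L / 2)) ?divr_ge0 ?(ltW L0)// addrC lerD2l.
have YS := Y_step m; have gE := gS m.
pose u := c * m.+1%:R.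
have uc : c <= u by rewrite /u ler_peMr.
have u2 : 2 <= u by apply: le_trans c2 uc.
have uA : A <= u by apply: le_trans uc; rewrite /c lerDl.
have even_bd : `|G m.+1.*2| <= Y m.+1 * g m.+1.
  have M2 : 0 < 2 * m.+1%:R :> R by rewrite mulr_gt0.
  rewrite -(ler_pM2l M2) -{1}(gtr0_norm M2) -normrM G_even_rec.
  have -> : 2 * m.+1%:R * (Y m.+1 * g m.+1) = Y m.+1 * L * g m.
    by rewrite mulrCA gE mulrA.
  apply: (le_trans (ler_normD _ _)).
  have t := tail_le m (Y m) m.*2.+1 (leqnSn _) mL' y0 cr.
  apply: (le_trans (lerD (ler_normD _ _) t)); rewrite !normrM.
  apply: (le_trans (lerD (lerD (ler_pM _ _ psi0 h2) (ler_pM _ _ p1 h1)) (lexx _))) => //.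
  apply: le_trans (ler_wpM2r gm YS).
  have -> : A * (c * m.+1%:R * Y m * g m) + (L + A) * (Y m * g m)
    + 4 * c ^+ 2 * Y m * m.+1%:R ^+ 2 * g m = Y m *
    (A * c * m.+1%:R + (L + A) + 4 * c ^+ 2 * m.+1%:R ^+ 2) * g m by ring.
  rewrite ler_wpM2r// ler_wpM2l// /q.
  have -> : A * c * m.+1%:R = A * u by rewrite /u; ring.
  have -> : 4 * c ^+ 2 * m.+1%:R ^+ 2 = 4 * u ^+ 2 by rewrite /u; ring.
  have -> : 10 * c ^+ 2 * m.+1%:R ^+ 2 = 10 * u ^+ 2 by rewrite /u; ring.
  by move: uA u2 A1; move: (u) => v; nra.
split=> //.
have M2 : 0 < 2 * m.+1%:R + 1 :> R by rewrite addr_gt0// mulr_gt0.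
rewrite -(ler_pM2l M2) -{1}(gtr0_norm M2) -normrM G_odd_rec.
have t := tail_le m (Y m) m.+1.*2 (ltnW (ltnW (leqnn _))) mL' y0 cr.
apply: (le_trans (ler_normD _ _)).
apply: (le_trans (lerD (ler_normD _ _) t)).
apply: (le_trans (lerD (lerD (ler_normD _ _) (lexx _)) (lexx _))); rewrite !normrM.
apply: (le_trans (lerD (lerD (lerD (ler_pM _ _ psi0 even_bd) (ler_pM _ _ p1 h2))
   (ler_pM _ _ p2 h1)) (lexx _))) => //.
pose W := Y m.+1 * g m.+1; pose T := Y m * g m.
have W0 : 0 <= W by rewrite mulr_ge0.
have T0 : 0 <= T by rewrite mulr_ge0.
have WT : (L + 10 * u ^+ 2) * T <= 2 * m.+1%:R * W.
  have -> : 2 * m.+1%:R * W = Y m.+1 * L * g m by rewrite /W mulrCA gE mulrA.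
  have -> : (L + 10 * u ^+ 2) * T = Y m * (L + q * m.+1%:R ^+ 2) * g m.
    by rewrite /u /q /T exprMn; ring.
  by rewrite ler_wpM2r.
have -> : A * (Y m.+1 * g m.+1) + (L + A) * (c * m.+1%:R * Y m * g m)
  + (L / 2 + A) * (Y m * g m) + 4 * c ^+ 2 * Y m * m.+1%:R ^+ 2 * g m =
  A * W + ((L + A) * u + (L / 2 + A) + 4 * u ^+ 2) * T.
  by rewrite /u /W /T exprMn; ring.
(* Passing from m+1 to m+2 in the odd bound adds c to u; since c >= 2, this pays for psi_2, which is
   close to L/2. *)
have -> : (2 * m.+1%:R + 1) * (c * m.+2%:R * Y m.+1 * g m.+1) =
  (u + c) * (2 * m.+1%:R * W) + (u + c) * W.
  by rewrite /u /W -[m.+2%:R]natr1; ring.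
have cu0 : 0 <= u + c by move: c0 u2; lra.
rewrite [leLHS]addrC; apply: lerD; last by apply: ler_wpM2r => //; move: c0 uA; lra.
apply: le_trans (ler_wpM2l cu0 WT); rewrite [leRHS]mulrA; apply: ler_wpM2r => //.
move: uA u2 uc c2 c0 A1 L1; move: (u) (c) => v d; nra.
Qed.

(** 6 = 1 + 1 + 4: with u = c (m+1), the quantities A and A u are each at most u^2, and the tail
    contributes 4 u^2. *)
Let C1 : R := 6 * c ^+ 2 * Q.
Let C2 : R := (c + 1) * C1.

Let Q0 : 0 <= Q. Proof. exact: expR_ge0. Qed.

Let C10 : 0 <= C1. Proof. by rewrite mulr_ge0// mulr_ge0// exprn_ge0. Qed.

Let crude_Q m : 8 * m%:R ^+ 3 <= L -> crude m.+1 Q.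
Proof.
move=> mL i im; have [h1 h2] := crude_Y _ mL i im.
have gi := ltW (g_gt0 i); have yq := Y_leQ _ mL; split.
  by apply: (le_trans h1); rewrite ler_wpM2r.
by apply: (le_trans h2); rewrite ler_wpM2r// ler_wpM2l// mulr_ge0.
Qed.

(** The first two terms serve both parities: they cover (psi_1 - L) G_{2m} and psi_0 G_{2m+1} in an
    even step, (psi_2 - L/2) G_{2m} and (psi_1 - L) G_{2m+1} in an odd one. *)
Let remainder_le m N : 8 * m%:R ^+ 3 <= L -> (m.*2 <= N)%N ->
  A * `|G m.*2| + A * `|G m.*2.+1| + `|\sum_(0 <= i < m.*2) psi (N - i) * G i|
    <= C1 * m.+1%:R ^+ 2 * g m.
Proof.
move=> mL mN; have A0 : 0 <= A by move: A1; lra.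
have cr := crude_Q _ mL; have [h1 h2] := cr m (ltnSn m).
have gm := ltW (g_gt0 m).
have M1 : 1 <= m.+1%:R :> R by rewrite ler1n.
have cr' : crude m Q by move=> i im; apply: cr; rewrite leqW.
apply: (le_trans (lerD (lerD (ler_wpM2l A0 h1) (ler_wpM2l A0 h2))
  (tail_le _ _ _ mN mL Q0 cr'))).
pose u := c * m.+1%:R.
have uA : A <= u.
  by apply: (@le_trans _ _ c); [rewrite /c lerDl|rewrite /u ler_peMr].
have u1 : 1 <= u by apply: le_trans uA.
have -> : A * (Q * g m) + A * (c * m.+1%:R * Q * g m)
   + 4 * c ^+ 2 * Q * m.+1%:R ^+ 2 * g m = (A + A * u + 4 * u ^+ 2) * (Q * g m).
  by rewrite /u; ring.
have -> : C1 * m.+1%:R ^+ 2 * g m = 6 * u ^+ 2 * (Q * g m) by rewrite /C1 /u; ring.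
apply: ler_wpM2r; first exact: mulr_ge0.
by move: uA u1 A1; move: (u) => v; nra.
Qed.

(** 2(m+1) times the error at m+1 is at most L times the error at m plus the remainder. As L g_m =
    2(m+1) g_{m+1}, the induction reduces to m^3 + (m+1)^2 <= (m+1)^3. *)
Let even_asymp m : 8 * m%:R ^+ 3 <= L ->
  L * `|G m.*2 - g m| <= C1 * m%:R ^+ 3 * g m.
Proof.
elim: m => [|m IH] mL.
  by rewrite G0 /g expr0 fact0 divr1 subrr normr0 mulr0 expr0n/= mulr0 mul0r.
have mL' := cube_mono _ mL; have {}IH := IH mL'.
have M2 : 0 < 2 * m.+1%:R :> R by rewrite mulr_gt0.
rewrite -(ler_pM2l M2).
have -> : 2 * m.+1%:R * (L * `|G m.+1.*2 - g m.+1|) =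
  L * `|2 * m.+1%:R * (G m.+1.*2 - g m.+1)|.
  by rewrite normrM (gtr0_norm M2); ring.
have -> : 2 * m.+1%:R * (C1 * m.+1%:R ^+ 3 * g m.+1) =
  L * (C1 * m.+1%:R ^+ 3 * g m).
  by rewrite mulrCA gS; ring.
rewrite ler_pM2l// mulrBr G_even_rec gS.
have -> : psi 0 * G m.*2.+1 + psi 1 * G m.*2
  + \sum_(0 <= i < m.*2) psi (m.*2.+1 - i) * G i - L * g m =
  L * (G m.*2 - g m) + ((psi 1 - L) * G m.*2 + psi 0 * G m.*2.+1 +
  \sum_(0 <= i < m.*2) psi (m.*2.+1 - i) * G i) by ring.
apply: (le_trans (ler_normD _ _)).
rewrite normrM (gtr0_norm L0).
have r := remainder_le _ _ mL' (leqnSn m.*2).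
have p1 : `|psi 1 - L| <= A by have := psi_near 1 isT; rewrite divr1.
have h : `|(psi 1 - L) * G m.*2 + psi 0 * G m.*2.+1 +
  \sum_(0 <= i < m.*2) psi (m.*2.+1 - i) * G i| <= C1 * m.+1%:R ^+ 2 * g m.
  apply: le_trans r; apply: (le_trans (ler_normD _ _)); rewrite lerD2r.
  apply: (le_trans (ler_normD _ _)); rewrite !normrM.
  by apply: lerD; rewrite ler_wpM2r.
apply: (le_trans (lerD IH h)); rewrite -!mulrDl -mulrDr.
apply: ler_wpM2r; first exact: ltW.
apply: ler_wpM2l => //; rewrite -natr1.
have : 0 <= m%:R :> R by []. nra.
Qed.

(** Up to errors, r_m = G_{2m+1}/g_m satisfies (2m+3) r_{m+1} = 2(m+1) r_m + (m+1) + psi_0, where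
    m+1 comes from psi_2 close to L/2. The solution with r_0 = psi_0 is m/3 + psi_0. *)
Let odd_asymp m : 8 * m%:R ^+ 3 <= L ->
  L * `|G m.*2.+1 - g m * (m%:R / 3 + psi 0)| <= C2 * m%:R ^+ 4 * g m.
Proof.
elim: m => [|m IH] mL.
  rewrite G1 /g expr0 fact0 divr1 mul0r mul1r add0r subrr normr0 mulr0.
  by rewrite expr0n/= mulr0 mul0r.
have mL' := cube_mono _ mL; have {}IH := IH mL'.
have M2 : 0 < 2 * m.+1%:R + 1 :> R by rewrite addr_gt0// mulr_gt0.
have gm := g_gt0 m; have gm' := g_gt0 m.+1.
have M1 : 1 <= m.+1%:R :> R by rewrite ler1n.
have C20 : 0 <= C2 by rewrite mulr_ge0//; move: c0; lra.
have b1 : 2 * `|G m.+1.*2 - g m.+1| <= C1 * m.+1%:R ^+ 2 * g m.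
  rewrite -(ler_pM2l L0).
  have -> : L * (C1 * m.+1%:R ^+ 2 * g m) = 2 * (C1 * m.+1%:R ^+ 3 * g m.+1).
    by rewrite mulrCA -gS; ring.
  by rewrite mulrCA ler_pM2l//; exact: even_asymp.
have key : `|(2 * m.+1%:R + 1) * (G m.+1.*2.+1 - g m.+1 * (m.+1%:R / 3 + psi 0))|
   <= C2 * m.+1%:R ^+ 4 * g m.
  rewrite mulrBr G_odd_rec.
  have -> : psi 0 * G m.+1.*2 + psi 1 * G m.*2.+1 + psi 2 * G m.*2
    + \sum_(0 <= i < m.*2) psi (m.+1.*2 - i) * G i
    - (2 * m.+1%:R + 1) * (g m.+1 * (m.+1%:R / 3 + psi 0)) =
    psi 0 * (G m.+1.*2 - g m.+1) + L * (G m.*2.+1 - g m * (m%:R / 3 + psi 0)) +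
    L * (G m.*2 - g m) / 2 +
    ((psi 2 - L / 2) * G m.*2 + (psi 1 - L) * G m.*2.+1 +
    \sum_(0 <= i < m.*2) psi (m.+1.*2 - i) * G i).
    have gE : 2 * m.+1%:R * g m.+1 = L * g m := gS m.
    have -> : L * (G m.*2.+1 - g m * (m%:R / 3 + psi 0)) =
      L * G m.*2.+1 - (L * g m) * (m%:R / 3 + psi 0) by ring.
    have -> : L * (G m.*2 - g m) / 2 = L * G m.*2 / 2 - (L * g m) / 2 by ring.
    by rewrite -gE -[m.+1%:R]natr1; field.
  have r := remainder_le _ _ mL' (ltnW (ltnW (leqnn m.+1.*2))).
  have p1 : `|psi 1 - L| <= A by have := psi_near 1 isT; rewrite divr1.
  have p2 : `|psi 2 - L / 2| <= A by have := psi_near 2 isT.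
  have h : `|(psi 2 - L / 2) * G m.*2 + (psi 1 - L) * G m.*2.+1 +
    \sum_(0 <= i < m.*2) psi (m.+1.*2 - i) * G i| <= C1 * m.+1%:R ^+ 2 * g m.
    apply: le_trans r; apply: (le_trans (ler_normD _ _)); rewrite lerD2r.
    apply: (le_trans (ler_normD _ _)); rewrite !normrM.
    by apply: lerD; rewrite ler_wpM2r.
  apply: (le_trans (ler_normD _ _)); apply: (le_trans (lerD (ler_normD _ _) h)).
  apply: (le_trans (lerD (lerD (ler_normD _ _) (lexx _)) (lexx _))).
  rewrite !normrM (gtr0_norm L0) (@gtr0_norm _ 2^-1)//.
  have b2 := even_asymp _ mL'.
  have b3 : `|psi 0| * `|G m.+1.*2 - g m.+1| <= A * (C1 * m.+1%:R ^+ 2 * g m / 2).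
    by apply: ler_pM => //; rewrite ler_pdivlMr// mulrC.
  have b4 : L * `|G m.*2 - g m| / 2 <= C1 * m%:R ^+ 3 * g m / 2.
    by rewrite ler_wpM2r.
  apply: (le_trans (lerD (lerD (lerD b3 IH) b4) (lexx _))).
  have -> : A * (C1 * m.+1%:R ^+ 2 * g m / 2) + C2 * m%:R ^+ 4 * g m +
    C1 * m%:R ^+ 3 * g m / 2 + C1 * m.+1%:R ^+ 2 * g m =
    ((A / 2 + 1) * m.+1%:R ^+ 2 + m%:R ^+ 3 / 2 + (c + 1) * m%:R ^+ 4) * (C1 * g m).
    by rewrite /C2; ring.
  have -> : C2 * m.+1%:R ^+ 4 * g m = (c + 1) * m.+1%:R ^+ 4 * (C1 * g m).
    by rewrite /C2; ring.
  apply: ler_wpM2r; first by rewrite mulr_ge0// ltW.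
  rewrite /c; have A0 : 0 <= A by move: A1; lra.
  rewrite -[m.+1%:R]natr1; have : 0 <= m%:R :> R by [].
  move: (m%:R) A0 => t A0 t0.
  have t2 : 0 <= t ^+ 2 by rewrite exprn_ge0.
  have t3 : 0 <= t ^+ 3 by rewrite exprn_ge0.
  have At : 0 <= A * t by rewrite mulr_ge0.
  have At2 : 0 <= A * t ^+ 2 by rewrite mulr_ge0.
  have At3 : 0 <= A * t ^+ 3 by rewrite mulr_ge0.
  rewrite -subr_ge0.
  have -> : (A + 1 + 1) * (t + 1) ^+ 4 -
    ((A / 2 + 1) * (t + 1) ^+ 2 + t ^+ 3 / 2 + (A + 1 + 1) * t ^+ 4) =
    4 * (A * t ^+ 3) + (15 / 2) * t ^+ 3 + (11 / 2) * (A * t ^+ 2) + 11 * t ^+ 2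
    + 3 * (A * t) + 6 * t + A / 2 + 1 by field.
  lra.
rewrite -(ler_pM2l M2).
have -> : (2 * m.+1%:R + 1) * (L * `|G m.+1.*2.+1 - g m.+1 * (m.+1%:R / 3 + psi 0)|) =
  L * `|(2 * m.+1%:R + 1) * (G m.+1.*2.+1 - g m.+1 * (m.+1%:R / 3 + psi 0))|.
  by rewrite normrM (gtr0_norm M2); ring.
apply: (le_trans (ler_wpM2l (ltW L0) key)).
have -> : L * (C2 * m.+1%:R ^+ 4 * g m) = 2 * m.+1%:R * (C2 * m.+1%:R ^+ 4 * g m.+1).
  by rewrite [RHS]mulrCA gS; ring.
apply: ler_wpM2r; last by rewrite lerDl.
by apply: mulr_ge0; [apply: mulr_ge0 => //; exact: exprn_ge0|exact: ltW].
Qed.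

(** [C2] with its abbreviations unfolded: a function of A alone, which makes the final constant
    absolute. *)
Definition recurrence_const : R := (A + 2) * (6 * (A + 1) ^+ 2 * expR (10 * (A + 1) ^+ 2)).

Lemma recurrence_asymptotics m : 8 * m%:R ^+ 3 <= L ->
  `|G m.*2 - (L / 2) ^+ m / m`!%:R| <=
    recurrence_const * (m%:R ^+ 3 / L) * ((L / 2) ^+ m / m`!%:R) /\
  `|G m.*2.+1 - (L / 2) ^+ m / m`!%:R * (m%:R / 3 + psi 0)| <=
    recurrence_const * (m%:R ^+ 4 / L) * ((L / 2) ^+ m / m`!%:R).
Proof.
move=> mL; rewrite -/(g m).
have -> : recurrence_const = C2 by rewrite /recurrence_const /C2 /C1 /Q /q /c; ring.
have C12 : C1 <= C2 by rewrite /C2 ler_peMl//; move: c0; lra.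
split; rewrite -(ler_pM2l L0).
  apply: (le_trans (even_asymp _ mL)).
  have -> : L * (C2 * (m%:R ^+ 3 / L) * g m) = C2 * m%:R ^+ 3 * g m.
    by field; exact: lt0r_neq0.
  by rewrite ler_wpM2r ?(ltW (g_gt0 _))// ler_wpM2r// exprn_ge0.
apply: (le_trans (odd_asymp _ mL)).
by rewrite le_eqVlt; apply/orP; left; apply/eqP; field; exact: lt0r_neq0.
Qed.

End Recurrence.

(** * Moments of a sum of Bernoulli variables *)

(** The Cauchy product: generating functions are treated as formal power series, so that no question
    of convergence arises. *)
Definition conv {R : realType} (f g : nat -> R) (n : nat) : R :=
  \sum_(0 <= i < n.+1) f (n - i)%N * g i.

Lemma eq_conv (R : realType) (f f' g g' : nat -> R) :
  f =1 f' -> g =1 g' -> conv f g =1 conv f' g'.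
Proof. by move=> ff gg n; apply: eq_bigr => i _; rewrite ff gg. Qed.

(** Coefficient n does not see a truncation at degree N >= n. Commutativity, associativity and the
    product rule are inherited from polynomials in this way. *)
Lemma conv_coef (R : realType) (N : nat) (f g : nat -> R) (n : nat) : (n <= N)%N ->
  conv f g n = ((\poly_(i < N.+1) f i) * (\poly_(i < N.+1) g i))`_n.
Proof.
move=> nN; rewrite coefMr /conv big_mkord; apply: eq_bigr => i _.
rewrite !coef_poly !ltnS (leq_trans (leq_subr _ _))//.
by rewrite (leq_trans _ nN)// -ltnS ltn_ord.
Qed.

Lemma convC (R : realType) (f g : nat -> R) : conv f g =1 conv g f.
Proof. by move=> n; rewrite !(@conv_coef _ n)// mulrC. Qed.

Lemma convA (R : realType) (f g h : nat -> R) :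
  conv f (conv g h) =1 conv (conv f g) h.
Proof.
move=> n; pose P (f : nat -> R) := \poly_(i < n.+1) f i.
have PE (f0 : nat -> R) i : (i <= n)%N -> (P f0)`_i = f0 i
  by move=> ni; rewrite coef_poly ltnS ni.
transitivity (P f * (P g * P h))`_n.
  rewrite coefMr /conv big_mkord; apply: eq_bigr => i _.
  have ni : (i <= n)%N by rewrite -ltnS.
  by rewrite PE ?leq_subr// -(conv_coef _ n).
rewrite mulrA coefMr /conv big_mkord; apply: eq_bigr => i _.
have ni : (i <= n)%N by rewrite -ltnS.
by rewrite PE// -(conv_coef _ n) ?leq_subr.
Qed.

Lemma convDl (R : realType) (f g h : nat -> R) (n : nat) :
  conv (fun i => f i + g i) h n = conv f h n + conv g h n.
Proof. by rewrite /conv -big_split; apply: eq_bigr => i _; rewrite mulrDl. Qed.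

Lemma deriv_conv (R : realType) (f g : nat -> R) (n : nat) :
  n.+1%:R * conv f g n.+1 = conv (fun i => i.+1%:R * f i.+1) g n
    + conv f (fun i => i.+1%:R * g i.+1) n.
Proof.
pose P (f : nat -> R) := \poly_(i < n.+2) f i.
have PE (f0 : nat -> R) i : (i <= n.+1)%N -> (P f0)`_i = f0 i
  by move=> ni; rewrite coef_poly ltnS ni.
rewrite (conv_coef _ n.+1)// mulr_natl -coef_deriv derivM coefD.
congr (_ + _); rewrite coefMr /conv big_mkord; apply: eq_bigr => i _.
all: have ni : (i <= n)%N by rewrite -ltnS.
- rewrite -/(P f) -/(P g) coef_deriv (PE f) ?ltnS ?leq_subr// (PE g) ?leqW//.
  by rewrite mulr_natl.
- rewrite -/(P f) -/(P g) coef_deriv (PE g) ?ltnS// (PE f) ?mulr_natl//.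
  by rewrite (leq_trans (leq_subr _ _)).
Qed.

(** Recursion on all earlier values, realised by growing a list; it serves to divide one formal
    series by another in [logistic_coef]. *)
Lemma exists_course_of_values (T : Type) (x0 : T) (F : nat -> (nat -> T) -> T) :
  (forall n f g, (forall i, (i < n)%N -> f i = g i) -> F n f = F n g) ->
  exists c : nat -> T, forall n, c n = F n c.
Proof.
move=> FP.
pose fix l n := if n is n'.+1 then rcons (l n') (F n' (nth x0 (l n'))) else [::].
have sl n : size (l n) = n by elim: n => //= n IH; rewrite size_rcons IH.
have nl n i : (i < n)%N -> nth x0 (l n) i = nth x0 (l i.+1) i.
  elim: n => // n IH; rewrite ltnS leq_eqVlt => /orP[/eqP ->//|ni].
  by rewrite [l n.+1]/= nth_rcons sl ni IH.
exists (fun n => nth x0 (l n.+1) n) => n.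
rewrite [l n.+1]/= nth_rcons sl ltnn eqxx; apply: FP => i ni.
exact: nl.
Qed.

(** * Logarithmic derivatives of Bernoulli factors *)

Lemma sum_inv_fact_le (R : realType) (n : nat) :
  \sum_(0 <= i < n) ((n - i)`!%:R)^-1 <= 7 / 4 :> R.
Proof.
have -> : \sum_(0 <= i < n) ((n - i)`!%:R)^-1 =
    \sum_(1 <= j < n.+1) (j`!%:R)^-1 :> R.
  by rewrite big_nat_rev/= big_add1/= big_nat [RHS]big_nat; apply: eq_bigr => i /andP[_ ni];
    rewrite add0n subKn.
case: n => [|[|n]]; first by rewrite big_geq//; lra.
  by rewrite big_nat1 factS fact0 muln1; lra.
(* The bound 7/4 lies just above e - 1; the subtracted term majorises the tail and makes the
   induction work. *)
suff : \sum_(1 <= j < n.+3) (j`!%:R)^-1 <= 7 / 4 - (2 * (n.+2)`!%:R)^-1 :> R.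
  by move=> /le_trans; apply; rewrite gerBl invr_ge0 mulr_ge0.
elim: n => [|n IH].
  by rewrite big_nat_recr//= big_nat1 !factS fact0 !muln1; lra.
rewrite big_nat_recr//=; apply: (le_trans (lerD IH (lexx _))).
have f0 : 0 < (n.+2)`!%:R :> R by rewrite ltr0n fact_gt0.
rewrite [(n.+3)`!]factS natrM; have n3 : 3 <= n.+3%:R :> R by rewrite ler_nat.
move: ((n.+2)`!%:R) (n.+3%:R) f0 n3 => f m f0 m3.
have m0 : 0 < m by lra.
rewrite -subr_ge0.
have -> : 7 / 4 - (2 * (m * f))^-1 - (7 / 4 - (2 * f)^-1 + (m * f)^-1) =
  (m - 3) / (2 * (m * f)) by field; rewrite !gt_eqF.
by rewrite divr_ge0 ?subr_ge0// ltW// !mulr_gt0.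
Qed.

(* Coefficients of 1 + u (e^t - 1). *)
Definition bern {R : realType} (u : R) (n : nat) : R :=
  if n is 0 then 1 else u / n`!%:R.

Lemma conv_bern (R : realType) (u : R) (f : nat -> R) (n : nat) :
  conv (bern u) f n = f n + u * \sum_(0 <= i < n) f i / (n - i)`!%:R.
Proof.
rewrite /conv big_nat_recr//= subnn mul1r addrC; congr (_ + _).
rewrite big_distrr/= big_nat [RHS]big_nat; apply: eq_bigr => i /andP[_ ni].
case e : (n - i)%N => [|j]; last by rewrite /bern; ring.
by move/eqP: e; rewrite subn_eq0 leqNgt ni.
Qed.

(* c is the coefficient sequence of the logarithmic derivative
   u e^t / (1 + u (e^t - 1)) of the series of [bern u]. *)
Lemma logistic_coef (R : realType) (u : R) : 0 <= u <= 1 / 2 ->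
  exists c : nat -> R, [/\ c 0 = u,
    forall n, conv (bern u) c n = n.+1%:R * bern u n.+1 &
    forall n, `|c n - u / n`!%:R| <= 14 * u ^+ 2].
Proof.
move=> /andP[u0 u2].
pose F n (f : nat -> R) := u / n`!%:R - u * \sum_(0 <= i < n) f i / (n - i)`!%:R.
have [|c cE] := @exists_course_of_values R 0 F.
  move=> n f g fg; rewrite /F; congr (_ - _ * _).
  by rewrite big_nat [RHS]big_nat; apply: eq_bigr => i /andP[_ /fg ->].
have sb n M : 0 <= M -> (forall i, (i < n)%N -> `|c i| <= M) ->
    `|u * \sum_(0 <= i < n) c i / (n - i)`!%:R| <= u * (M * (7 / 4)).
  move=> M0 cM; rewrite normrM (ger0_norm u0) ler_wpM2l//.
  apply: (le_trans (ler_norm_sum _ _ _)).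
  apply: le_trans (ler_wpM2l M0 (sum_inv_fact_le R n)).
  rewrite big_distrr/= big_nat [leRHS]big_nat; apply: ler_sum => i /andP[_ ni].
  by rewrite normrM (@ger0_norm _ (_^-1)) ?invr_ge0// ler_wpM2r ?invr_ge0// cM.
(* The constant 8 reproduces itself exactly up to u = 1/2: u + u (8u)(7/4) = u (1 + 14u) <= 8u. *)
have c8 n : `|c n| <= 8 * u.
  elim/ltn_ind: n => n IH; rewrite cE; apply: (le_trans (ler_normB _ _)).
  have h : `|u / n`!%:R| <= u.
    rewrite ger0_norm ?divr_ge0// ler_pdivrMr ?ltr0n ?fact_gt0//.
    by rewrite ler_peMr// ler1n fact_gt0.
  apply: (le_trans (lerD h (sb n (8 * u) _ IH))); first lra.
  nra.
exists c; split.
- by rewrite cE /F big_geq// mulr0 subr0 fact0 divr1.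
- move=> n; rewrite conv_bern cE /F subrK /bern factS natrM; field.
  by rewrite nat1r !pnatr_eq0 -lt0n fact_gt0.
- move=> n; rewrite {1}cE /F addrAC subrr add0r normrN.
  apply: (le_trans (sb n (8 * u) _ (fun i _ => c8 i))); first lra.
  by rewrite le_eqVlt; apply/orP; left; apply/eqP; field.
Qed.

Fixpoint bern_mgf {R : realType} (L : R) (s : seq R) : nat -> R :=
  if s is u :: s' then conv (bern u) (bern_mgf L s')
  else fun n => (- L) ^+ n / n`!%:R.

Lemma bern_mgf0 (R : realType) (L : R) (s : seq R) : bern_mgf L s 0 = 1.
Proof.
elim: s => [|u s IH]; first by rewrite /= expr0 fact0 divr1.
by rewrite /= /conv big_nat1 subnn /= IH mulr1.
Qed.

(** The logarithmic derivative of a product is the sum of those of its factors, starting from -L for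
    e^(-Lt). The argument uses the product rule and [convA], without dividing series. *)
Lemma bern_mgf_rec (R : realType) (L : R) (s : seq R) :
  (forall u, u \in s -> 0 <= u <= 1 / 2) ->
  exists psi : nat -> R, [/\ psi 0 = \sum_(u <- s) u - L,
    forall n, n.+1%:R * bern_mgf L s n.+1 = conv psi (bern_mgf L s) n &
    forall j, (0 < j)%N ->
      `|psi j - (\sum_(u <- s) u) / j`!%:R| <= 14 * \sum_(u <- s) u ^+ 2].
Proof.
elim: s => [_|u s IH su].
  exists (fun n => if n is 0 then - L else 0); split.
  - by rewrite big_nil add0r.
  - move=> n; rewrite /conv big_nat_recr//= subnn big_nat big1 ?add0r.
      rewrite exprS factS natrM; field.
      by rewrite nat1r !pnatr_eq0 -lt0n fact_gt0.
    move=> i /andP[_ ni]; case e : (n - i)%N => [|j]; last by rewrite mul0r.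
    by move/eqP: e; rewrite subn_eq0 leqNgt ni.
  - by case=> // j _; rewrite !big_nil mul0r subr0 normr0 mulr0.
have [|psi [psi0 psiE psib]] := IH; first by move=> v vs; rewrite su// inE vs orbT.
have [|c [c0 cE cb]] := logistic_coef _ u; first by rewrite su// mem_head.
exists (fun n => c n + psi n); split.
- by rewrite c0 psi0 big_cons addrA.
- move=> n; rewrite [bern_mgf L (u :: s)]/= deriv_conv convDl; congr (_ + _).
    rewrite convA; apply: eq_conv => // i.
    by rewrite convC cE.
  rewrite (eq_conv _ _ _ _ _ (fun=> erefl) psiE) !convA.
  by apply: eq_conv => // i; exact: convC.
- move=> j j0; rewrite !big_cons mulrDl mulrDr opprD addrACA.
  by apply: (le_trans (ler_normD _ _)); apply: lerD; [exact: cb|exact: psib].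
Qed.

(** * Moments of omega *)

Lemma expD1_fact (R : realType) (a : R) (k : nat) :
  (a + 1) ^+ k / k`!%:R = \sum_(0 <= i < k.+1) a ^+ i / i`!%:R / (k - i)`!%:R.
Proof.
rewrite addrC exprDn big_mkord big_distrl/=; apply: eq_bigr => i _.
have ik : (i <= k)%N by rewrite -ltnS.
rewrite expr1n mul1r -(bin_fact ik) !natrM -mulr_natr.
field; rewrite !pnatr_eq0 -!lt0n !fact_gt0 /= bin_gt0 ik.
by [].
Qed.

Lemma sum_dvdn (R : realType) (X d : nat) (a : R) : (0 < d)%N ->
  \sum_(1 <= n < X.+1 | (d %| n)%N) a = (X %/ d)%:R * a.
Proof.
move=> d0; elim: X => [|X IH]; first by rewrite big_geq// div0n mul0r.
rewrite big_mkcond big_nat_recr//= -big_mkcond/= IH divnS// natrD mulrDl addrC.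
by congr (_ + _); case: (d %| X.+1)%N; rewrite ?mul1r ?mul0r.
Qed.

Lemma divn_approx (R : realType) (x : R) (d : nat) : 0 <= x -> (0 < d)%N ->
  `|(Num.truncn x %/ d)%:R - x / d%:R| <= 1.
Proof.
move=> x0 d0; have [Xx xX] := andP (truncn_itv x0).
set X := Num.truncn x in Xx xX *.
have d0R : 0 < d%:R :> R by rewrite ltr0n.
have h1 : (X %/ d)%:R <= x / d%:R.
  by rewrite ler_pdivlMr// -natrM; apply: le_trans Xx; rewrite ler_nat leq_divM.
have h2 : x / d%:R <= (X %/ d)%:R + 1.
  rewrite ler_pdivrMr// natr1 -natrM; apply: le_trans (ltW xX) _.
  by rewrite ler_nat ltn_ceil.
by rewrite ler_norml; apply/andP; split; lra.
Qed.

(* The restriction to multiples of d makes the induction on P work: adding a prime p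
   to P splits the sum into those over the multiples of d and of dp. *)
Lemma moment_bern_mgf (R : realType) (L x : R) (P : seq nat) (d k : nat) :
  0 <= x -> 0 <= L -> (0 < d)%N -> uniq P -> all prime P -> all (coprime d) P ->
  `|\sum_(1 <= n < (Num.truncn x).+1 | (d %| n)%N)
      ((\sum_(p <- P) (p %| n))%N%:R - L) ^+ k / k`!%:R
    - x / d%:R * bern_mgf L [seq p%:R^-1 | p <- P] k|
  <= (L + (size P)%:R) ^+ k / k`!%:R.
Proof.
move=> x0 L0; elim: P d k => [|p P IH] d k d0.
  move=> _ _ _; rewrite (eq_bigr (fun=> (- L) ^+ k / k`!%:R)); last first.
    by move=> n _; rewrite big_nil sub0r.
  rewrite sum_dvdn//= -mulrBl normrM addr0.
  have -> : `|(- L) ^+ k / k`!%:R| = L ^+ k / k`!%:R.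
    by rewrite normrM normrX normrN (ger0_norm L0) ger0_norm// invr_ge0.
  by apply: ler_piMl; rewrite ?divn_approx// divr_ge0// exprn_ge0.
move=> /= /andP[pP uP] /andP[pp aP] /andP[dp cP].
have p0 := prime_gt0 pp.
pose T (e j : nat) := \sum_(1 <= n < (Num.truncn x).+1 | (e %| n)%N)
      ((\sum_(p <- P) (p %| n))%N%:R - L) ^+ j / j`!%:R.
have cP' : all (coprime (d * p)) P.
  apply/allP => r rP; rewrite coprimeMl (allP cP _ rP)/=.
  rewrite prime_coprime// dvdn_prime2 ?(allP aP _ rP)//.
  by apply: contraNneq pP => ->.
have IH1 j := IH d j d0 uP aP cP.
have dp0 : (0 < d * p)%N by rewrite muln_gt0 d0.
have IH2 j := IH (d * p)%N j dp0 uP aP cP'.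
(* When p divides n the base grows by 1; [expD1_fact] expands the power, and its terms with i < k
   become sums over the multiples of dp. *)
have -> : \sum_(1 <= n < (Num.truncn x).+1 | (d %| n)%N)
      ((\sum_(p <- p :: P) (p %| n))%N%:R - L) ^+ k / k`!%:R =
   T d k + \sum_(0 <= i < k) T (d * p)%N i / (k - i)`!%:R.
  have -> : \sum_(0 <= i < k) T (d * p)%N i / (k - i)`!%:R =
      \sum_(1 <= n < (Num.truncn x).+1 | (d %| n)%N)
         \sum_(0 <= i < k) (p %| n)%:R *
       (((\sum_(p <- P) (p %| n))%N%:R - L) ^+ i / i`!%:R / (k - i)`!%:R).
    rewrite exchange_big/=; apply: eq_bigr => i _.
    rewrite /T big_distrl/= big_mkcond [RHS]big_mkcond; apply: eq_bigr => n _.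
    rewrite Gauss_dvd//; case: (d %| n)%N => //=.
    by case: (p %| n)%N; rewrite ?mul1r ?mul0r.
  rewrite -big_split/=; apply: eq_bigr => n _.
  rewrite big_cons natrD; case: (p %| n)%N; last first.
    by rewrite add0r [X in _ = _ + X]big1 ?addr0// => i _; rewrite mul0r.
  rewrite [1%:R + _]addrC addrAC expD1_fact big_nat_recr//= subnn fact0 divr1 addrC.
  by congr (_ + _); apply: eq_bigr => i _; rewrite mul1r.
(* The error bound obeys the same expansion, since the size of the list also grows by 1; the errors
   then match term by term. *)
rewrite conv_bern -natr1 addrA expD1_fact.
rewrite big_nat_recr//= subnn fact0 divr1 [leRHS]addrC.
have -> : T d k + \sum_(0 <= i < k) T (d * p)%N i / (k - i)`!%:R
  - x / d%:R * (bern_mgf L [seq p0%:R^-1 | p0 <- P] k + p%:R^-1 *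
     \sum_(0 <= i < k) bern_mgf L [seq p0%:R^-1 | p0 <- P] i / (k - i)`!%:R) =
  (T d k - x / d%:R * bern_mgf L [seq p0%:R^-1 | p0 <- P] k) +
  \sum_(0 <= i < k) (T (d * p)%N i - x / (d * p)%:R *
      bern_mgf L [seq p0%:R^-1 | p0 <- P] i) / (k - i)`!%:R.
  rewrite mulrDr opprD addrACA; congr (_ + _).
  rewrite mulrA big_distrr/= -sumrB; apply: eq_bigr => i _.
  by rewrite natrM invfM; ring.
apply: (le_trans (ler_normD _ _)); apply: lerD; first exact: IH1.
apply: (le_trans (ler_norm_sum _ _ _)); apply: ler_sum => i _.
rewrite normrM (@ger0_norm _ (_^-1)) ?invr_ge0// ler_wpM2r ?invr_ge0//.
exact: IH2.
Qed.

Lemma omegaE (R : realType) (z : R) (n : nat) : 0 <= z -> (0 < n)%N ->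
  omega z n = (\sum_(p <- [seq p <- index_iota 0 (Num.truncn z).+1 | prime p])
    (p %| n))%N.
Proof.
move=> z0 n0; rewrite /omega sum1_count -big_mkcond/= sum1_count count_filter.
rewrite -!size_filter; apply: perm_size; apply: uniq_perm.
- by rewrite filter_uniq// primes_uniq.
- by rewrite filter_uniq// iota_uniq.
move=> p; rewrite !mem_filter mem_primes n0 mem_iota add1n ltnS truncn_ge_nat//=.
case: (boolP (prime p)) => pp; rewrite ?andbF //= prime_gt0// andbT.
exact: andbC.
Qed.

Lemma sum_inv_prime_sqr_le (R : realType) (n : nat) :
  \sum_(0 <= p < n.+1 | prime p) (p%:R^-1) ^+ 2 <= 2 :> R.
Proof.
case: n => [|n]; first by rewrite prime_sumS big_geq//= addr0.
suff : \sum_(0 <= p < n.+2 | prime p) (p%:R^-1) ^+ 2 <= 2 - n.+1%:R^-1 :> R.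
  by move=> /le_trans; apply; rewrite gerBl invr_ge0.
elim: n => [|n IH]; first by rewrite !prime_sumS big_geq//= invr1; lra.
rewrite prime_sumS; apply: (le_trans (lerD IH (lexx _))).
have M1 : 1 <= n.+1%:R :> R by rewrite ler1n.
apply: (@le_trans _ _ (2 - n.+1%:R^-1 + (n.+2%:R^-1) ^+ 2)).
  by rewrite lerD2l; case: ifP; rewrite // exprn_ge0 ?invr_ge0.
rewrite -[n.+2%:R]natr1; move: n.+1%:R M1 => M M1.
rewrite -subr_ge0.
have -> : 2 - (M + 1)^-1 - (2 - M^-1 + (M + 1)^-1 ^+ 2) = (M * (M + 1) ^+ 2)^-1.
  by field; rewrite !gt_eqF//; lra.
by rewrite invr_ge0 mulr_ge0 ?exprn_ge0//; lra.
Qed.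

Lemma powR_invn_le (R : realType) (a b : R) (n : nat) : (0 < n)%N ->
  0 <= a -> 0 <= b -> a <= b `^ (1 / n%:R) -> a ^+ n <= b.
Proof.
move=> n0 a0 b0 ab; apply: (@le_trans _ _ ((b `^ (1 / n%:R)) ^+ n)).
  by rewrite lerXn2r ?nnegrE ?powR_ge0.
by rewrite -powR_mulrn ?powR_ge0// -powRrM mul1r mulVf ?pnatr_eq0 -?lt0n// powRr1.
Qed.

Lemma powR_invn_ge (R : realType) (a b : R) (n : nat) : (0 < n)%N ->
  0 <= b -> b `^ (1 / n%:R) <= a -> b <= a ^+ n.
Proof.
move=> n0 b0 ab; apply: (@le_trans _ _ ((b `^ (1 / n%:R)) ^+ n)); last first.
  by rewrite lerXn2r ?nnegrE ?powR_ge0// (le_trans _ ab) ?powR_ge0.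
by rewrite -powR_mulrn ?powR_ge0// -powRrM mul1r mulVf ?pnatr_eq0 -?lt0n// powRr1.
Qed.

Lemma loglog_ge (R : realType) (z a : R) : expR (expR a) <= z -> a <= loglog z.
Proof.
move=> az; rewrite /loglog -[leLHS]expRK ler_ln ?posrE ?expR_gt0//.
  by rewrite -[leLHS]expRK ler_ln ?posrE ?expR_gt0// (lt_le_trans (expR_gt0 _) az).
by rewrite ln_gt0// (lt_le_trans _ az)// expR_gt1 expR_gt0.
Qed.

(** Ensures that k!/(2^m m!) is at least 1, so that the main term dominates L^m. *)
Lemma exp2_fact_le (m : nat) : (2 ^ m * m`! <= (m.*2)`!)%N.
Proof.
elim: m => // m IH; rewrite doubleS !factS expnS.
have -> : (2 * 2 ^ m * (m.+1 * m`!) = m.*2.+2 * (2 ^ m * m`!))%N.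
  by rewrite -doubleS -mul2n mulnACA mulnA.
by rewrite leq_pmul2l// (leq_trans IH)// leq_pmull.
Qed.

Lemma recurrence_const_ge0 (R : realType) (A : R) :
  0 <= A -> 0 <= recurrence_const R A.
Proof.
move=> A0; rewrite mulr_ge0 ?addr_ge0// mulr_ge0 ?expR_ge0// mulr_ge0//.
by rewrite exprn_ge0// addr_ge0.
Qed.

Section Moments.
Variables (R : realType) (x z : R) (k : nat).
Hypotheses (k2 : (2 <= k)%N) (x1 : 1 <= x).
Hypothesis zk : expR (expR (k%:R ^+ 3)) <= z.
Hypothesis zx : z <= x `^ (1 / k%:R).

Let L : R := loglog z.
Let m : nat := k./2.
Let P : seq nat := [seq p <- index_iota 0 (Num.truncn z).+1 | prime p].
Let s : seq R := [seq p%:R^-1 | p <- P].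
(** 44 = 16 + 28: psi_0 is within 16 of B, and the terms 14/p^2 sum to at most 28. *)
Let A : R := `|Bcst R| + 44.
Let main : R := k`!%:R * ((L / 2) ^+ m / m`!%:R).

Let kL : k%:R ^+ 3 <= L. Proof. exact: loglog_ge. Qed.

Let k3 : 8 <= k%:R ^+ 3 :> R.
Proof.
have -> : 8 = 2 ^+ 3 :> R by rewrite !exprS expr0; lra.
by rewrite lerXn2r ?nnegrE// ler_nat.
Qed.

Let L8 : 8 <= L. Proof. exact: le_trans kL. Qed.

Let m0 : (0 < m)%N. Proof. by rewrite /m; case: (k) k2 => [|[|j]]. Qed.

Let lnz_gt1 : 1 < ln z.
Proof.
have h := zk; have e0 := expR_gt0 (expR (k%:R ^+ 3 : R)).
have : expR (k%:R ^+ 3) <= ln z.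
  by rewrite -[leLHS]expRK ler_ln ?posrE//; exact: lt_le_trans h.
by apply: lt_le_trans; rewrite expR_gt1; move: k3; lra.
Qed.

Let z1 : 1 < z.
Proof.
by have := zk; apply: lt_le_trans; rewrite expR_gt1 expR_gt0.
Qed.

Let L_le_lnz : L <= ln z.
Proof. by rewrite ltW// ln_sublinear//; move: lnz_gt1; lra. Qed.

(** Because 2m <= k; this is the origin of the factor 8 in the condition under which the recurrence
    is analysed. *)
Let mL : 8 * m%:R ^+ 3 <= L.
Proof.
apply: le_trans kL; have -> : 8 * m%:R ^+ 3 = (m.*2)%:R ^+ 3 :> R.
  by rewrite -mul2n natrM; ring.
rewrite lerXn2r ?nnegrE// ler_nat /m.
by rewrite -[leqRHS]odd_double_half leq_addl.
Qed.

Let sumE : \sum_(u <- s) u - L =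
  \sum_(0 <= p < (Num.truncn z).+1 | prime p) (p%:R)^-1 - loglog z.
Proof. by rewrite /s big_map big_filter. Qed.

Let b_near : `|\sum_(u <- s) u - L - Bcst R| <= 16 / L.
Proof.
rewrite sumE; apply: (le_trans (mertens2 R z _)).
  have := ln_sublinear (lt_trans ltr01 z1); move: L8 L_le_lnz; lra.
by rewrite ler_wpM2l// lef_pV2 ?posrE//; move: L8 lnz_gt1; lra.
Qed.

Let mgf_asymp :
  (~~ odd k -> `|k`!%:R * bern_mgf L s k - main|
     <= recurrence_const R A * (m%:R ^+ 3 / L) * main) /\
  (odd k -> `|k`!%:R * bern_mgf L s k - main * (m%:R / 3 + (\sum_(u <- s) u - L))|
     <= recurrence_const R A * (m%:R ^+ 4 / L) * main).
Proof.
have L1 : 1 <= L by move: L8; lra.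
have A1 : 1 <= A by rewrite /A; have := normr_ge0 (Bcst R); lra.
have su u : u \in s -> 0 <= u <= 1 / 2.
  move=> /mapP[p]; rewrite mem_filter => /andP[pp _] ->.
  rewrite invr_ge0 ler0n/= div1r lef_pV2 ?posrE ?ltr0n ?prime_gt0//.
  by rewrite ler_nat prime_gt1.
have [psi [psi0 psiE psib]] := bern_mgf_rec _ L _ su.
have bA : `|psi 0| <= `|Bcst R| + 16.
  rewrite psi0 -[X in `|X|](subrK (Bcst R)) addrC.
  apply: (le_trans (ler_normD _ _)); rewrite lerD2l; apply: (le_trans b_near).
  by rewrite ler_pdivrMr; move: L1; lra.
have psiA : `|psi 0| <= A by rewrite /A; move: bA; lra.
have psin j : (0 < j)%N -> `|psi j - L / j`!%:R| <= A.
  (* The sum of the 1/p is L + psi_0, so replacing it by L costs psi_0/j!. *)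
  move=> j0; have -> : psi j - L / j`!%:R =
    (psi j - (\sum_(u <- s) u) / j`!%:R) + psi 0 / j`!%:R by rewrite psi0; ring.
  apply: (le_trans (ler_normD _ _)).
  have h1 : `|psi j - (\sum_(u <- s) u) / j`!%:R| <= 28.
    apply: (le_trans (psib _ j0)); rewrite /s big_map big_filter.
    have := sum_inv_prime_sqr_le R (Num.truncn z).
    by move: (\sum_(_ <= _ < _ | _) _) => S; lra.
  have h2 : `|psi 0 / j`!%:R| <= `|psi 0|.
    rewrite normrM (@ger0_norm _ (_^-1)) ?invr_ge0//.
    by rewrite ler_pdivrMr ?ltr0n ?fact_gt0// ler_peMr// ler1n fact_gt0.
  by move: h1 h2 bA; rewrite /A; lra.
have [He Ho] := recurrence_asymptotics R A L psi (bern_mgf L s) A1 L1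
   (bern_mgf0 _ _ _) psiE psiA psin m mL.
have f0 : 0 <= k`!%:R :> R by [].
have kE := odd_double_half k; rewrite -/m in kE.
split=> [ek|ok].
  rewrite (negbTE ek) add0n in kE; rewrite kE in He.
  rewrite /main -mulrBr normrM (ger0_norm f0) mulrCA; exact: ler_wpM2l.
rewrite ok add1n in kE; rewrite kE psi0 in Ho.
rewrite /main -mulrA -mulrBr normrM (ger0_norm f0) mulrCA; exact: ler_wpM2l.
Qed.

Let moment_near : `|moment k z x - x * (k`!%:R * bern_mgf L s k)| <= 2 ^+ k * x.
Proof.
have z0 : 0 <= z by move: z1; lra.
have x0 : 0 <= x by move: x1; lra.
have L0 : 0 <= L by move: L8; lra.
have kf : 0 < k`!%:R :> R by rewrite ltr0n fact_gt0.
have uP : uniq P by rewrite filter_uniq// iota_uniq.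
have aP : all prime P by exact: filter_all.
have cP : all (coprime 1) P by apply/allP => p _; exact: coprime1n.
have := moment_bern_mgf R L x P 1 k x0 L0 isT uP aP cP.
rewrite divr1 -/s -(ler_pM2l kf) -{1}(gtr0_norm kf) -normrM mulrBr.
have -> : k`!%:R * \sum_(1 <= n < (Num.truncn x).+1 | (1 %| n)%N)
   ((\sum_(p <- P) (p %| n))%N%:R - L) ^+ k / k`!%:R = moment k z x.
  rewrite big_distrr/= /moment big_nat_cond [RHS]big_nat_cond; apply: eq_big => n.
    by rewrite dvd1n.
  move=> /andP[/andP[n0 _] _]; rewrite omegaE//.
  by field; rewrite gt_eqF.
rewrite mulrCA => /le_trans; apply.
rewrite mulrCA divff ?gt_eqF// mulr1.
apply: (@le_trans _ _ ((2 * z) ^+ k)).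
  rewrite lerXn2r ?nnegrE ?addr_ge0 ?mulr_ge0//.
  rewrite mulr_natl mulr2n; apply: lerD.
    by apply: (le_trans L_le_lnz); rewrite ltW// ln_sublinear//; move: z1; lra.
  have [h _] := andP (truncn_itv z0); apply: le_trans h; rewrite ler_nat.
  by rewrite /P size_filter/= (leq_trans (count_size _ _))// size_iota.
rewrite exprMn ler_wpM2l ?exprn_ge0//.
by apply: powR_invn_le => //; exact: leq_trans k2.
Qed.

Let main_gt0 : 0 < main.
Proof.
rewrite mulr_gt0 ?divr_gt0 ?ltr0n ?fact_gt0// exprn_gt0//; move: L8; lra.
Qed.

(** Absorbs the error 2^k x of [moment_near]. Dividing by L leaves L^(m-1) >= 8^(m-1), and k^3 >= 8
    restores the lost factor; 8^m >= 2^(2m+1) >= 2^k because m >= 1. *)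
Let pow2_le : 2 ^+ k <= k%:R ^+ 3 / L * main.
Proof.
have mE : m = m.-1.+1 by rewrite prednK.
have L0 : 0 < L by move: L8; lra.
have fm : 0 < m`!%:R :> R by rewrite ltr0n fact_gt0.
have -> : k%:R ^+ 3 / L * main =
  k%:R ^+ 3 * (L ^+ m.-1 * (k`!%:R / (2 ^+ m * m`!%:R))).
  have p2 : 0 < 2 ^+ m :> R by rewrite exprn_gt0.
  have -> : main = k`!%:R * (L * L ^+ m.-1 / 2 ^+ m / m`!%:R).
    by rewrite -exprS -mE -exprVn -exprMn.
  by field; rewrite !gt_eqF.
have D1 : 1 <= k`!%:R / (2 ^+ m * m`!%:R) :> R.
  rewrite ler_pdivlMr ?mulr_gt0 ?exprn_gt0// mul1r -natrX -natrM ler_nat.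
  apply: (leq_trans (exp2_fact_le m)); rewrite -[k in leqRHS]odd_double_half -/m.
  by case: (odd k); rewrite ?add0n// add1n factS leq_pmull.
have h8 : 8 ^+ m.-1 <= L ^+ m.-1 by rewrite lerXn2r ?nnegrE// ltW.
have p8 : 0 <= 8 ^+ m.-1 :> R by rewrite exprn_ge0.
apply: (@le_trans _ _ (8 * 8 ^+ m.-1)); last first.
  apply: ler_pM => //.
  by apply: (le_trans h8); rewrite ler_peMr// (le_trans p8).
have -> : 8 * 8 ^+ m.-1 = 2 ^+ m * (2 ^+ 2) ^+ m :> R.
  by rewrite -exprS -mE -exprMn; congr (_ ^+ _); rewrite expr2; lra.
have -> : 2 ^+ k = 2 ^+ (odd k) * (2 ^+ 2) ^+ m :> R.
  by rewrite -exprM -exprD mul2n odd_double_half.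
apply: ler_wpM2r; first by rewrite !exprn_ge0.
by rewrite ler_weXn2l ?ler1n// (leq_trans (leq_b1 _)).
Qed.

Let const_ge0 : 0 <= recurrence_const R A.
Proof. by apply: recurrence_const_ge0; rewrite /A addr_ge0. Qed.

Lemma moment_even : ~~ odd k ->
  `|moment k z x - x * main| <=
  (recurrence_const R A + 1) * (k%:R ^+ 3 / L) * (x * main).
Proof.
move=> ek; have [h _] := mgf_asymp; have {}h := h ek.
have L0 : 0 < L by move: L8; lra.
have x0 : 0 < x by move: x1; lra.
have -> : moment k z x - x * main = (moment k z x - x * (k`!%:R * bern_mgf L s k))
  + x * (k`!%:R * bern_mgf L s k - main) by ring.
apply: (le_trans (ler_normD _ _)); rewrite normrM (gtr0_norm x0).
have h2 := ler_wpM2l (ltW x0) h; have h3 := ler_wpM2l (ltW x0) pow2_le.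
have mk : m%:R ^+ 3 / L <= k%:R ^+ 3 / L.
  rewrite ler_wpM2r ?invr_ge0 ?(ltW L0)// lerXn2r ?nnegrE// ler_nat.
  by rewrite -[leqRHS]odd_double_half -/m -addnn addnA leq_addl.
have h4 : recurrence_const R A * (m%:R ^+ 3 / L) * main
   <= recurrence_const R A * (k%:R ^+ 3 / L) * main.
  by rewrite ler_wpM2r ?(ltW main_gt0)// ler_wpM2l.
have h5 := ler_wpM2l (ltW x0) h4.
have h6 := moment_near; rewrite [2 ^+ k * x]mulrC in h6.
have -> : (recurrence_const R A + 1) * (k%:R ^+ 3 / L) * (x * main) =
  x * (k%:R ^+ 3 / L * main) + x * (recurrence_const R A * (k%:R ^+ 3 / L) * main) by ring.
apply: lerD; first exact: le_trans h3.
exact: le_trans h5.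
Qed.

(** 17 = 1 + 16: the 1 absorbs 2^k x, and the 16 comes from replacing psi_0 by B at the rate
    16/L. *)
Lemma moment_odd : odd k ->
  `|moment k z x - x * main * (m%:R / 3 + Bcst R)| <=
  (recurrence_const R A + 17) * (k%:R ^+ 4 / L) * (x * main).
Proof.
move=> ok; have [_ h] := mgf_asymp; have {}h := h ok.
have L0 : 0 < L by move: L8; lra.
have x0 : 0 < x by move: x1; lra.
set b := \sum_(u <- s) u - L in h; have bB : `|b - Bcst R| <= 16 / L := b_near.
have -> : moment k z x - x * main * (m%:R / 3 + Bcst R) =
  (moment k z x - x * (k`!%:R * bern_mgf L s k))
  + x * (k`!%:R * bern_mgf L s k - main * (m%:R / 3 + b))
  + (x * main) * (b - Bcst R) by ring.
have xm0 : 0 < x * main by rewrite mulr_gt0.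
apply: (le_trans (ler_normD _ _)); apply: (le_trans (lerD (ler_normD _ _) (lexx _))).
rewrite [`|x * (_ - _)|]normrM [`|x * main * _|]normrM (gtr0_norm x0) (gtr0_norm xm0).
have h2 := ler_wpM2l (ltW x0) h; have h3 := ler_wpM2l (ltW x0) pow2_le.
have k1 : 1 <= k%:R :> R by rewrite ler1n (leq_trans _ k2).
have iL : 0 <= L^-1 by rewrite invr_ge0 ltW.
have mk : m%:R ^+ 4 / L <= k%:R ^+ 4 / L.
  rewrite ler_wpM2r// lerXn2r ?nnegrE// ler_nat.
  by rewrite -[leqRHS]odd_double_half -/m -addnn addnA leq_addl.
have h4 : recurrence_const R A * (m%:R ^+ 4 / L) * main
   <= recurrence_const R A * (k%:R ^+ 4 / L) * main.
  by rewrite ler_wpM2r ?(ltW main_gt0)// ler_wpM2l.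
have h5 := ler_wpM2l (ltW x0) h4.
have h6 := moment_near; rewrite [2 ^+ k * x]mulrC in h6.
have h7 : x * (k%:R ^+ 3 / L * main) <= k%:R ^+ 4 / L * (x * main).
  rewrite mulrCA ler_wpM2r ?(ltW xm0)// ler_wpM2r//.
  by rewrite [leRHS]exprS ler_peMl// exprn_ge0.
have h8 : x * main * `|b - Bcst R| <= 16 * (k%:R ^+ 4 / L * (x * main)).
  rewrite mulrC mulrA ler_wpM2r ?(ltW xm0)//; apply: (le_trans bB).
  by rewrite ler_wpM2l// ler_peMl// exprn_ege1.
have -> : (recurrence_const R A + 17) * (k%:R ^+ 4 / L) * (x * main) =
  k%:R ^+ 4 / L * (x * main) + x * (recurrence_const R A * (k%:R ^+ 4 / L) * main)
  + 16 * (k%:R ^+ 4 / L * (x * main)) by ring.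
apply: lerD h8; apply: lerD.
  by apply: (le_trans h6); apply: (le_trans h3).
exact: (le_trans h2).
Qed.

End Moments.

(** * The theorem *)

Lemma half_natr_double (R : realType) (m : nat) : (m.*2)%:R / 2 = m%:R :> R.
Proof. by rewrite -mul2n natrM; field. Qed.

Lemma half_natr_doubleS (R : realType) (m : nat) :
  (m.*2.+1)%:R / 2 = m%:R + 2^-1 :> R.
Proof. by rewrite -natr1 -mul2n natrM; field. Qed.

Lemma Ccst_even (R : realType) (m : nat) :
  Ccst R m.*2 = (m.*2)`!%:R / (2 ^+ m * m`!%:R).
Proof. by rewrite /Ccst half_natr_double !Gamma_succn powR_mulrn. Qed.

Lemma Ccst_odd (R : realType) (m : nat) : Ccst R m.*2.+1 =
  (m.*2.+1)`!%:R / (2 ^+ m * Num.sqrt 2 * Gamma (m%:R + 2^-1 + 1 : R)).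
Proof.
rewrite /Ccst half_natr_doubleS Gamma_succn powRD ?pnatr_eq0 ?implybT//.
by rewrite powR_mulrn// powR12_sqrt.
Qed.

Lemma Ccst_odd_gt0 (R : realType) (m : nat) : 0 < Ccst R m.*2.+1.
Proof.
rewrite Ccst_odd divr_gt0 ?ltr0n ?fact_gt0//.
by rewrite !mulr_gt0 ?exprn_gt0 ?sqrtr_gt0 ?Gamma_half_gt0.
Qed.

(** Gamma(m + 3/2) cancels against the denominator of C_k, and the remaining value is Gamma(m + 1) =
    m!. *)
Lemma Ctilde_odd (R : realType) (m : nat) : Ctilde R m.*2.+1 =
  (m.*2.+1)`!%:R / (2 ^+ m * m`!%:R) * (m%:R / 3).
Proof.
have G0 := Gamma_half_gt0 R m.
have s0 : 0 < Num.sqrt 2 :> R by rewrite sqrtr_gt0.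
have f0 : 0 < m`!%:R :> R by rewrite ltr0n fact_gt0.
have p0 : 0 < 2 ^+ m :> R by rewrite exprn_gt0.
rewrite /Ctilde Ccst_odd half_natr_doubleS.
have -> : m%:R + 2^-1 + 1 / 2 = m%:R + 1 :> R by field.
rewrite Gamma_succn.
have -> : (m.*2.+1)%:R - 1 = 2 * m%:R :> R.
  by rewrite -natr1 -mul2n natrM addrK.
by field; rewrite !gt_eqF.
Qed.

Lemma powR_three_half (R : realType) (a : R) : 0 < a ->
  a `^ (3 / 2) = a * Num.sqrt a.
Proof.
move=> a0; have -> : 3 / 2 = 1 + 2^-1 :> R by field.
by rewrite powRD ?(gt_eqF a0) ?implybT// powRr1 ?ltW// powR12_sqrt// ltW.
Qed.

(** Reduces to sqrt 2 Gamma(m + 3/2) <= 2 sqrt k m!, which follows from [Gamma_half_le] and 2(m+1)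
    <= 4k. It trades one factor k of the error for the normalisation k^{3/2} C_k. *)
Lemma scale_odd_ge (R : realType) (m : nat) :
  (m.*2.+1)%:R * ((m.*2.+1)`!%:R / (2 ^+ m * m`!%:R)) <=
  2 * ((m.*2.+1)%:R `^ (3 / 2) * Ccst R m.*2.+1).
Proof.
set k := m.*2.+1.
have k0 : 0 < k%:R :> R by rewrite ltr0n.
have G0 := Gamma_half_gt0 R m; have Gle := Gamma_half_le R m.
have s0 : 0 < Num.sqrt 2 :> R by rewrite sqrtr_gt0.
have f0 : 0 < m`!%:R :> R by rewrite ltr0n fact_gt0.
have fk : 0 < k`!%:R :> R by rewrite ltr0n fact_gt0.
have p0 : 0 < 2 ^+ m :> R by rewrite exprn_gt0.
have sk0 : 0 < Num.sqrt k%:R :> R by rewrite sqrtr_gt0.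
rewrite powR_three_half// /k Ccst_odd -/k.
have -> : 2 * (k%:R * Num.sqrt k%:R *
    (k`!%:R / (2 ^+ m * Num.sqrt 2 * Gamma (m%:R + 2^-1 + 1)))) =
  k%:R * k`!%:R / 2 ^+ m *
    (2 * Num.sqrt k%:R / (Num.sqrt 2 * Gamma (m%:R + 2^-1 + 1))) :> R.
  by field; rewrite !gt_eqF.
have -> : k%:R * (k`!%:R / (2 ^+ m * m`!%:R)) = k%:R * k`!%:R / 2 ^+ m * m`!%:R^-1 :> R.
  by field; rewrite !gt_eqF.
apply: ler_wpM2l; first by rewrite divr_ge0 ?mulr_ge0 ?(ltW p0).
rewrite ler_pdivlMr ?mulr_gt0// mulrC ler_pdivrMr//.
apply: (le_trans (ler_wpM2l (ltW s0) Gle)); rewrite mulrA; apply: ler_wpM2r.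
  exact: ltW.
rewrite -sqrtrM//; have -> : 2 = Num.sqrt (2 ^+ 2) :> R by rewrite sqrtr_sqr ger0_norm.
rewrite -sqrtrM ?sqr_ge0// ler_sqrt ?mulr_ge0 ?sqr_ge0//.
rewrite sqrtr_sqr ger0_norm// expr2 -mulrA ler_wpM2l// -natrM ler_nat.
by rewrite /k mul2n doubleS ltnS leqW// -!addnn -addnA leq_addr.
Qed.

Theorem theorem1p2 (R : realType) :
  exists K x0 z0 : R,
    [/\ 0 < K, 1 <= x0, 1 <= z0 &
    forall (x z : R) (k : nat),
      x0 <= x -> z0 <= z -> (2 <= k)%N ->
      k%:R <= loglog z `^ (1 / 3) ->
      expR (expR (k%:R ^+ 3)) <= z ->
      z <= x `^ (1 / k%:R) ->
      (~~ odd k ->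
        exists2 E : R, `|E| <= K * (k%:R ^+ 3 / loglog z) &
          moment k z x = Ccst R k * x * loglog z `^ (k%:R / 2) * (1 + E))
      /\
      (odd k ->
        let main := Ctilde R k * x * loglog z `^ ((k%:R - 1) / 2) in
        let scale :=
          (k%:R `^ (3 / 2) * Ccst R k) * x * loglog z `^ ((k%:R - 1) / 2) in
        let second :=
          Bcst R * scale * (Ccst R k.-1 / (k%:R `^ (1 / 2) * Ccst R k)) in
        [/\ k%:R <= loglog z `^ (1 / 7) ->
              `|moment k z x - (main + second)|
                <= K * (scale * (1 / (k%:R * loglog z) `^ (1 / 2))),
            loglog z `^ (1 / 7) < k%:R -> k%:R < loglog z `^ (1 / 4) ->
              `|moment k z x - (main + second)|
                <= K * (scale * (k%:R ^+ 3 / loglog z)) &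
            loglog z `^ (1 / 4) <= k%:R -> k%:R <= loglog z `^ (1 / 3) ->
              `|moment k z x - main|
                <= K * (scale * (k%:R ^+ 3 / loglog z))])].
Proof.
pose K0 := recurrence_const R (`|Bcst R| + 44).
have K00 : 0 <= K0.
  by apply: recurrence_const_ge0; rewrite addr_ge0.
have B0 : 0 <= `|Bcst R| by [].
(* The factor 2 is the loss in passing to [scale]; |B| pays for moving the second term into the
   error when L <= k^4. *)
pose K := 2 * (K0 + 17 + `|Bcst R|).
have K17 : K0 + 17 + `|Bcst R| = K / 2 by rewrite /K; field.
exists K, 1, 1; split=> //; first by rewrite /K; lra.
move=> x z k x1 _ k2 _ zk zx.
have x0 : 0 < x by lra.
have k0 : 0 < k%:R :> R by rewrite ltr0n (leq_trans _ k2).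
have kL := loglog_ge _ _ _ zk.
set L := loglog z in kL *.
have L0 : 0 < L by apply: lt_le_trans kL; rewrite exprn_gt0.
pose m := k./2.
have kE := odd_double_half k; rewrite -/m in kE.
have f0 : 0 < m`!%:R :> R by rewrite ltr0n fact_gt0.
have p0 : 0 < 2 ^+ m :> R by rewrite exprn_gt0.
pose E := k`!%:R * ((L / 2) ^+ m / m`!%:R).
have E0 : 0 < E.
  by rewrite mulr_gt0 ?divr_gt0 ?ltr0n ?fact_gt0// exprn_gt0// divr_gt0.
split=> [ek|ok].
- rewrite (negbTE ek) add0n in kE.
  have Lk : L `^ (k%:R / 2) = L ^+ m.
    by rewrite -kE half_natr_double powR_mulrn// ltW.
  have ME : Ccst R k * x * L `^ (k%:R / 2) = x * E.
    rewrite Lk /E -{1}kE Ccst_even kE exprMn exprVn.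
    by field; rewrite !gt_eqF.
  have xE : 0 < x * E by rewrite mulr_gt0.
  have := moment_even R x z k k2 x1 zk zx ek; rewrite -/L -/m -/E -/K0 => h.
  exists ((moment k z x - x * E) / (x * E)).
    rewrite normrM normfV (gtr0_norm xE) ler_pdivrMr//.
    apply: (le_trans h); apply: ler_wpM2r; first exact: ltW.
    apply: ler_wpM2r; first by rewrite divr_ge0 ?ltW// exprn_gt0.
    by rewrite /K; lra.
  by rewrite ME; field; rewrite !gt_eqF.
- rewrite ok add1n in kE.
  have Lk : L `^ ((k%:R - 1) / 2) = L ^+ m.
    have -> : (k%:R - 1) / 2 = m%:R :> R.
      by rewrite -kE -natr1 addrK half_natr_double.
    by rewrite powR_mulrn// ltW.
  move=> main scale second.
  have Ck0 : 0 < Ccst R k by rewrite -kE Ccst_odd_gt0.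
  have sk0 : 0 < Num.sqrt k%:R :> R by rewrite sqrtr_gt0.
  have mainE : main = x * E * (m%:R / 3).
    rewrite /main Lk /E -{1}kE Ctilde_odd kE exprMn exprVn.
    by field; rewrite !gt_eqF.
  (* An exact identity: k^{3/2} C_k over k^{1/2} C_k leaves k, and k C_{k-1} = k!/(2^m m!) since k-1
     = 2m. *)
  have secondE : second = x * E * Bcst R.
    rewrite /second /scale Lk powR_three_half// mul1r powR12_sqrt ?(ltW k0)//.
    have -> : Ccst R k.-1 = k`!%:R / k%:R / (2 ^+ m * m`!%:R).
      have k1 : k.-1 = m.*2 by rewrite -kE.
      have -> : k`!%:R = k%:R * (m.*2)`!%:R :> R.
        by rewrite -natrM -{1}kE factS kE.
      by rewrite k1 Ccst_even; field; rewrite !gt_eqF.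
    by rewrite /E exprMn exprVn; field; rewrite !gt_eqF.
  have scaleE : k%:R * (x * E) <= 2 * scale.
    rewrite /scale Lk.
    have -> : k%:R * (x * E) = k%:R * (k`!%:R / (2 ^+ m * m`!%:R)) * (x * L ^+ m).
      by rewrite /E exprMn exprVn; field; rewrite !gt_eqF.
    have -> : 2 * (k%:R `^ (3 / 2) * Ccst R k * x * L ^+ m) =
      2 * (k%:R `^ (3 / 2) * Ccst R k) * (x * L ^+ m) by ring.
    apply: ler_wpM2r; first by rewrite mulr_ge0 ?exprn_ge0// ltW.
    by have := scale_odd_ge R m; rewrite kE.
  have scale0 : 0 < scale.
    by do !apply: mulr_gt0 => //; rewrite ?powR_gt0 ?Lk ?exprn_gt0.
  have k30 : 0 <= k%:R ^+ 3 / L by rewrite divr_ge0 ?(ltW L0)// exprn_ge0.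
  have := moment_odd R x z k k2 x1 zk zx ok; rewrite -/L -/m -/E -/K0 => h.
  have k4E c : 0 <= c -> c * (k%:R ^+ 4 / L) * (x * E) <= 2 * c * (scale * (k%:R ^+ 3 / L)).
    move=> c0.
    have -> : c * (k%:R ^+ 4 / L) * (x * E) = c * (k%:R ^+ 3 / L) * (k%:R * (x * E)) by ring.
    have -> : 2 * c * (scale * (k%:R ^+ 3 / L)) = c * (k%:R ^+ 3 / L) * (2 * scale) by ring.
    by rewrite ler_wpM2l// mulr_ge0.
  have II : `|moment k z x - (main + second)| <= K * (scale * (k%:R ^+ 3 / L)).
    rewrite mainE secondE -mulrDr; apply: (le_trans h).
    apply: (le_trans (k4E _ _)); first lra.
    apply: ler_wpM2r; first by rewrite mulr_ge0// ltW.
    by rewrite /K; lra.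
  split=> // [k7|k4 _].
  (* In this range the estimate [II] is the stronger one: k^7 <= L amounts to k^3/L <=
     1/sqrt(kL). *)
  + apply: (le_trans II); apply: ler_wpM2l; first by rewrite /K; lra.
    apply: ler_wpM2l; first exact: ltW.
    have {}k7 := powR_invn_le _ _ _ 7 isT (ltW k0) (ltW L0) k7.
    have kL0 : 0 < k%:R * L by rewrite mulr_gt0.
    rewrite !div1r powR12_sqrt ?(ltW kL0)//.
    have s0 : 0 < Num.sqrt (k%:R * L) by rewrite sqrtr_gt0.
    rewrite ler_pdivrMr// mulrC ler_pdivlMr//.
    rewrite -(@ler_pXn2r _ 2)// ?nnegrE ?mulr_ge0 ?exprn_ge0 ?(ltW L0)//.
    rewrite exprMn sqr_sqrtr ?(ltW kL0)//.
    have -> : (k%:R ^+ 3) ^+ 2 * (k%:R * L) = k%:R ^+ 7 * L by ring.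
    by rewrite expr2 ler_wpM2r// ltW.
  (* Now k^4/L >= 1, so the second term itself fits into the error. *)
  + have {}k4 := powR_invn_ge _ _ _ 4 isT (ltW L0) k4.
    have -> : moment k z x - main = (moment k z x - (main + second)) + second by ring.
    apply: (le_trans (ler_normD _ _)).
    have xE : 0 < x * E by rewrite mulr_gt0.
    have h1 : `|second| <= `|Bcst R| * (k%:R ^+ 4 / L) * (x * E).
      rewrite secondE normrM (gtr0_norm xE) mulrC; apply: ler_wpM2r; first exact: ltW.
      by rewrite ler_peMr// ler_pdivlMr// mul1r.
    rewrite {1}mainE {1}secondE -mulrDr.
    apply: (le_trans (lerD h h1)); rewrite -mulrDl -mulrDl.
    apply: (le_trans (k4E _ _)); first by rewrite !addr_ge0.
    by rewrite /K.
Qed.
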